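(* Let $p\ge 2$ be an integer, let $\tilde Q_{\mathbb{Z}}$ be a non-deterministic Extended Ergodic CP Distribution on $\mathcal{M}^*\times\Lambda_p^{\mathbb{Z}}$, and let $\hat\nu\tilde Q_{\mathbb{Z}}$ be its pushforward by $\hat\nu(\nu,\boldsymbol{i})=\nu$. Then for every $f\in L^1(\mathcal{M}^*,\hat\nu\tilde Q_{\mathbb{Z}})$ and $\hat\nu\tilde Q_{\mathbb{Z}}$-almost every $\nu$, $$\lim_{N\to\infty}\frac{1}{\nu([0,N))}\sum_{n=0}^{N-1}\nu[n,n+1)\cdot f(t_n^*\nu)=\mathbb{E}_{\hat\nu\tilde Q_{\mathbb{Z}}}(f\mid\mathbb{J})(\nu),$$ where $\mathbb{J}$ is the $\sigma$-algebra of sets invariant under the map $t(\nu)=t^*_{\tau(\nu)}\nu$, with $\tau(\nu)=\min\{n\in\mathbb{N}: t_n\nu[0,1)>0\}$.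
   Context: All spaces are separable metric spaces with their Borel $\sigma$-algebras. $\mathcal{M}(\mathbb{R})$ is the space of positive Radon measures on $\mathbb{R}$ (including $0$) with the weak topology ($\nu_n\to\nu$ iff $\int f\,d\nu_n\to\int f\,d\nu$ for all $f\in C_c(\mathbb{R})$). For a measurable map $\rho$, $\rho\nu$ denotes the pushforward of $\nu$ by $\rho$. $\mathbb{N}=\{1,2,\ldots\}$. Normalization map (also denoted $N$; not to be confused with the summation bound): for $0\ne\nu\in\mathcal{M}(\mathbb{R})$ put $\psi(\nu)=\min\{n\in\mathbb{N}:\nu[-(n-1),n)>0\}$ and $N\nu=\nu/\nu[-(\psi(\nu)-1),\psi(\nu))$; put $N0=0$. $\mathcal{M}^*$ is the image of $\mathcal{M}(\mathbb{R})$ under this map, the space of normalized measures. Fix an integer $p\ge2$, $\Lambda_p=\{0,\ldots,p-1\}$. For $j\in\Lambda_p$: $[j)_p=[\frac jp,\frac{j+1}p)$ and $\rho_j(x)=px-j$. On $\mathcal{M}^*\times\Lambda_p^{\mathbb{Z}}$, with points $(\nu,\boldsymbol{i})$, $\boldsymbol{i}=(i_n)_{n\in\mathbb{Z}}$, let $\hat\nu(\nu,\boldsymbol{i})=\nu$, $\hat i_n(\nu,\boldsymbol{i})=i_n$, and $M_p(\nu,\boldsymbol{i})=(N\rho_{i_1}\nu,\boldsymbol{\sigma}(\boldsymbol{i}))$, where $(\boldsymbol{\sigma}(\boldsymbol{i}))_n=i_{n+1}$. A Borel probability measure $\tilde Q_{\mathbb{Z}}$ on $\mathcal{M}^*\times\Lambda_p^{\mathbb{Z}}$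 is adapted if for every $j\in\Lambda_p$ and almost every $(\nu,\boldsymbol{i})$, $\mathbb{P}_{\tilde Q_{\mathbb{Z}}}(\hat i_1=j\mid\hat\nu,(\hat i_n)_{n\le0})(\nu,\boldsymbol{i})=\nu[j)_p$. It is an Extended Ergodic CP Distribution (Extended ECPD) if it is adapted and is invariant and ergodic under $M_p$. It is deterministic if for almost every $(\nu,\boldsymbol{i})$, $\mathbb{P}_{\tilde Q_{\mathbb{Z}}}(\hat i_1=i_1\mid\hat\nu,(\hat i_n)_{n\le0})(\nu,\boldsymbol{i})=1$, and non-deterministic otherwise. Translations: $t_x(y)=y-x$ on $\mathbb{R}$, $t_x\nu$ is the pushforward, $t_x^*\nu=Nt_x\nu$. The map $t$ is defined where $\tau(\nu)<\infty$, which for a non-deterministic Extended ECPD is a set of full $\hat\nu\tilde Q_{\mathbb{Z}}$-measure; accordingly $\mathbb{J}$ consists of the Borel sets $A\subseteq\mathcal{M}^*$ with $t^{-1}A=A$ up to $\hat\nu\tilde Q_{\mathbb{Z}}$-null sets. *)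

(* Defs.v *)
From HB Require Import structures.
From mathcomp Require Import all_boot all_order all_algebra.
From mathcomp Require Import all_classical all_reals all_analysis.
From mathcomp Require Import measurable_realfun.

Set Implicit Arguments.
Unset Strict Implicit.
Unset Printing Implicit Defensive.

Import Order.TTheory GRing.Theory Num.Theory.
Import numFieldNormedType.Exports.

Local Open Scope classical_set_scope.
Local Open Scope ring_scope.

(* The smallest element of P; 0 by convention when P is empty. *)
Definition min_nat (P : set nat) : nat :=
  xget 0%N [set n | P n /\ forall m, P m -> (n <= m)%N].

(* T with the sigma-algebra generated by its open sets *)
Notation Borel T := (g_sigma_algebraType (@open T)).

Section radon_measures.
Context {R : realType}.

(* Set functions of the library are total: setting the value to 0 on non-Borel *)
(* sets makes equality of measures the same as equality on all Borel sets.     *)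
Definition borel_part (m : set R -> \bar R) (A : set R) : \bar R :=
  if `[< measurable A >] then m A else 0%E.

Lemma borel_partE (m : set R -> \bar R) A :
  measurable A -> borel_part m A = m A.
Proof. by move=> mA; rewrite /borel_part asboolT. Qed.

Section borel_part_measure.
Variable m : {measure set R -> \bar R}.

Let borel_part0 : borel_part m set0 = 0%E.
Proof. by rewrite borel_partE. Qed.

Let borel_part_ge0 A : (0 <= borel_part m A)%E.
Proof. by rewrite /borel_part; case: ifP. Qed.

Let borel_part_sigma_additive : semi_sigma_additive (borel_part m).
Proof.
move=> F mF tF mUF; rewrite borel_partE//.
under eq_fun do under eq_bigr do rewrite borel_partE//.
exact: measure_semi_sigma_additive.
Qed.

HB.instance Definition _ := isMeasure.Build _ _ _ (borel_part m)
  borel_part0 borel_part_ge0 borel_part_sigma_additive.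

End borel_part_measure.

(* A Borel measure on the line that is finite on compact sets is automatically *)
(* regular, hence Radon.                                                       *)
Record radon := Radon {
  radon_measure :> {measure set R -> \bar R} ;
  radon_finite : forall K : set R, compact K -> (radon_measure K < +oo)%E ;
  radon_borel : forall A : set R, ~ measurable A -> radon_measure A = 0%E }.

Lemma radon_eq (mu nu : radon) :
  (forall A, measurable A -> mu A = nu A) -> mu = nu.
Proof.
case: mu nu => [mu muf mub] [nu nuf nub] /= munu.
have E : mu = nu.
  apply: eq_measure; apply/funext => A.
  by have [/munu//|nA] := pselect (measurable A); rewrite mub// nub.
by subst nu; congr Radon; exact: Prop_irrelevance.
Qed.

Section mk_radon.
Variable m : {measure set R -> \bar R}.
Hypothesis mf : forall K : set R, compact K -> (m K < +oo)%E.

Lemma mk_finite (K : set R) : compact K -> (borel_part m K < +oo)%E.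
Proof. by move=> cK; rewrite borel_partE; [exact: mf|exact: compact_measurable]. Qed.

Lemma mk_borel (A : set R) : ~ measurable A -> borel_part m A = 0%E.
Proof. by move=> nA; rewrite /borel_part asboolF. Qed.

Definition mk_radon : radon := Radon mk_finite mk_borel.

End mk_radon.

Lemma mzero_finite (K : set R) : compact K -> (@mzero _ R R K < +oo)%E.
Proof. by move=> _; rewrite /mzero ltry. Qed.

Definition radon0 : radon := mk_radon mzero_finite.

Section pushforward.
Variable phi : R -> R.
Hypothesis cphi : continuous phi.
Hypothesis pphi : forall K : set R, compact K -> compact (phi @^-1` K).
Variable nu : radon.

Let mphi : measurable_fun [set: R] phi.
Proof. exact: continuous_measurable_fun. Qed.

Definition image_measure : set R -> \bar R := pushforward nu phi.

Let image0 : image_measure set0 = 0%E.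
Proof. exact: measure0. Qed.

Let image_ge0 A : (0 <= image_measure A)%E.
Proof. exact: measure_ge0. Qed.

Let image_sigma_additive : semi_sigma_additive image_measure.
Proof. exact: measure_semi_sigma_additive. Qed.

HB.instance Definition _ := isMeasure.Build _ _ _ image_measure
  image0 image_ge0 image_sigma_additive.

Lemma push_finite (K : set R) : compact K -> (image_measure K < +oo)%E.
Proof. by move=> /pphi; exact: radon_finite. Qed.

Definition push : radon := mk_radon push_finite.

End pushforward.

End radon_measures.

Arguments radon R : clear implicits.

HB.instance Definition _ (R : realType) := gen_eqMixin (radon R).
HB.instance Definition _ (R : realType) := gen_choiceMixin (radon R).
HB.instance Definition _ (R : realType) := isPointed.Build (radon R) radon0.

Section vague_topology.
Context {R : realType}.

Definition Cc : Type :=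
  {f : R -> R | continuous f /\ compact (closure [set x | f x != 0])}.

Definition Cc_integral (nu : radon R) : {ptws Cc -> R} :=
  fun f => \int[nu]_x (sval f x).

End vague_topology.

Arguments Cc R : clear implicits.

(* The coarsest topology making nu |-> \int f dnu continuous for all f in C_c. *)
HB.instance Definition _ (R : realType) :=
  Topological.copy (radon R) (initial_topology (@Cc_integral R)).

Section normalization.
Context {R : realType}.

Definition window (n : nat) : set R := `[- (n%:R - 1), n%:R[.

Definition psi (nu : radon R) : nat :=
  min_nat [set n | (1 <= n)%N /\ (0 < nu (window n))%E].

Definition normalizer (nu : radon R) : {nonneg R} :=
  (NngNum (fine_ge0 (measure_ge0 nu (window (psi nu)))))%R.

Lemma scale_finite (c : {nonneg R}) (nu : radon R) (K : set R) :
  compact K -> (mscale c nu K < +oo)%E.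
Proof.
move=> cK; rewrite /mscale; apply: lte_mul_pinfty => //.
exact: radon_finite.
Qed.

Definition scale (c : {nonneg R}) (nu : radon R) : radon R :=
  mk_radon (@scale_finite c nu).

(* For nu = 0 this gives 0, whatever the scaling factor. *)
Definition normalize (nu : radon R) : radon R :=
  scale ((normalizer nu)%:num^-1)%:nng nu.

Lemma normalize0 : normalize radon0 = radon0.
Proof.
by apply: radon_eq => A mA /=; rewrite !(borel_partE _ mA) /mscale/= (borel_partE _ mA) mule0.
Qed.

Definition normalized : set (radon R) := range normalize.

End normalization.

Definition mstar (R : realType) : Type := set_type (@normalized R).

HB.instance Definition _ (R : realType) :=
  Topological.copy (mstar R) (set_type (@normalized R)).

Section mstar.
Context {R : realType}.

Definition radon_of (nu : mstar R) : radon R := val nu.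
Coercion radon_of : mstar >-> radon.

Definition nrm (nu : radon R) : mstar R :=
  exist _ (normalize nu) (mem_set (imageT (@normalize R) nu)).

End mstar.

HB.instance Definition _ (R : realType) := isPointed.Build (mstar R) (nrm radon0).

Section translations.
Context {R : realType}.

Definition tr (x y : R) : R := y - x.

Lemma tr_continuous x : continuous (tr x).
Proof. by move=> y; apply: cvgB; [exact: cvg_id|exact: cvg_cst]. Qed.

Lemma tr_proper x (K : set R) : compact K -> compact (tr x @^-1` K).
Proof.
move=> cK; rewrite (_ : _ @^-1` _ = tr (- x) @` K).
  apply: continuous_compact => //; apply: continuous_subspaceT.
  exact: tr_continuous.
apply/seteqP; split => [y Ky|_ [z Kz <-]]; last by rewrite /= /tr opprK addrK.
by exists (tr x y) => //; rewrite /tr opprK subrK.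
Qed.

Definition translate (x : R) (nu : radon R) : radon R :=
  push (@tr_continuous x) (@tr_proper x) nu.

Definition tstar (x : R) (nu : mstar R) : mstar R := nrm (translate x nu).

Definition return_times (nu : mstar R) : set nat :=
  [set n | (1 <= n)%N /\ (0 < translate n%:R nu `[0%R, 1%R[%classic)%E].

Definition tau (nu : mstar R) : nat := min_nat (return_times nu).

Definition tmap (nu : mstar R) : mstar R := tstar (tau nu)%:R nu.

(* Preimage under the partial map tmap, which is defined where tau is finite. *)
Definition tmap_preimage (A : set (mstar R)) : set (mstar R) :=
  [set nu | return_times nu !=set0 /\ A (tmap nu)].

End translations.

Section conditional_expectation.
Context d {T : measurableType d} {R : realType} (P : probability T R).
Implicit Types (G : set (set T)) (f g : T -> R).

(* g is a version of E_P(f | G), for a sub-sigma-algebra G and integrable f. *)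
Definition is_condexp G f g : Prop :=
  [/\ forall B : set R, measurable B -> G (g @^-1` B),
      P.-integrable setT (EFin \o g) &
      forall A, G A -> (\int[P]_(x in A) (g x)%:E = \int[P]_(x in A) (f x)%:E)%E].

(* A choice of such a version; it is unique up to P-null sets. *)
Definition condexp G f : T -> R := xget (cst 0) [set g | is_condexp G f g].

Definition condprob G (E : set T) : T -> R := condexp G \1_E.

End conditional_expectation.

(* The alphabet {0, ..., p-1}; the proof hp only serves to make it inhabited. *)
Definition digit (p : nat) (hp : (2 <= p)%N) : Type := 'I_p.

Section digit.
Variables (p : nat) (hp : (2 <= p)%N).

HB.instance Definition _ := Topological.copy (digit hp) (discrete_topology 'I_p).
HB.instance Definition _ := isPointed.Build (digit hp) (Ordinal (ltnW hp)).

Definition digit_val (j : digit hp) : nat := nat_of_ord j.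

End digit.
Coercion digit_val : digit >-> nat.

Section extended_ECPD.
Context {R : realType} (p : nat) (hp : (2 <= p)%N).

Definition phase : Type := (mstar R * {ptws int -> digit hp})%type.

HB.instance Definition _ := Topological.on phase.
HB.instance Definition _ := Pointed.on phase.

Definition hatnu (x : Borel phase) : Borel (mstar R) := x.1.

Definition hati (n : int) (x : Borel phase) : digit hp := x.2 n.

Lemma measurable_hatnu : measurable_fun [set: Borel phase] hatnu.
Proof.
apply: (@measurability _ _ (Borel phase) (Borel (mstar R)) _ _ (@open (mstar R))) => // _ [U oU <-].
rewrite setTI; apply: sub_sigma_algebra.
by apply: open_comp => // -[x i] _; exact: cvg_fst.
Qed.

HB.instance Definition _ :=
  isMeasurableFun.Build _ _ _ _ hatnu measurable_hatnu.

Definition rho (j : digit hp) (x : R) : R := p%:R * x - (j : nat)%:R.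

Lemma rho_continuous j : continuous (rho j).
Proof.
move=> x; apply: cvgB; last exact: cvg_cst.
by apply: cvgM; [exact: cvg_cst|exact: cvg_id].
Qed.

Lemma rho_proper j (K : set R) : compact K -> compact (rho j @^-1` K).
Proof.
have p0 : p%:R != 0 :> R by rewrite pnatr_eq0 -lt0n ltnW.
pose h (y : R) := p%:R^-1 * (y + (j : nat)%:R).
move=> cK; rewrite (_ : _ @^-1` _ = h @` K).
  apply: continuous_compact => //; apply: continuous_subspaceT => x.
  apply: cvgM; first exact: cvg_cst.
  by apply: cvgD; [exact: cvg_id|exact: cvg_cst].
apply/seteqP; split => [y Ky|_ [z Kz <-]].
  by exists (rho j y) => //; rewrite /h /rho subrK mulKf.
by rewrite /= /rho /h mulVKf// addrK.
Qed.

Definition push_rho (j : digit hp) (nu : radon R) : radon R :=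
  push (@rho_continuous j) (@rho_proper j) nu.

Definition shift (i : {ptws int -> digit hp}) : {ptws int -> digit hp} :=
  fun n => i (n + 1).

Definition M_p (x : Borel phase) : Borel phase :=
  (nrm (push_rho (x.2 1) x.1), shift x.2).

Definition past : set (set (Borel phase)) :=
  <<s [set A | (exists2 B, measurable B & A = hatnu @^-1` B) \/
               (exists n j, n <= 0 /\ A = [set x | hati n x = j])] >>.

Definition cell (j : digit hp) : set R :=
  `[(j : nat)%:R / p%:R, (j : nat).+1%:R / p%:R[.

Section properties.
Variable Q : probability (Borel phase) R.

Definition nu_law : probability (Borel (mstar R)) R := distribution Q hatnu.

Definition adapted : Prop :=
  forall j : digit hp, {ae Q, forall x : Borel phase,
    (condprob Q past [set y | hati 1 y = j] x)%:E = (hatnu x : mstar R) (cell j)}.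

Definition invariant : Prop :=
  forall A, measurable A -> Q (M_p @^-1` A) = Q A.

Definition ergodic : Prop :=
  forall A, measurable A -> M_p @^-1` A = A -> Q A = 0%E \/ Q A = 1%E.

Definition extended_ECPD : Prop := [/\ adapted, invariant & ergodic].

Definition deterministic : Prop :=
  {ae Q, forall x : Borel phase,
    condprob Q past [set y | hati 1 y = hati 1 x] x = 1}.

End properties.

End extended_ECPD.

Arguments phase R {p} hp.
Arguments hatnu {R p hp} x.
Arguments hati {R p hp} n x.
Arguments M_p {R p hp} x.

(* The Borel sets A with t^-1 A = A up to P-null sets. *)
Definition invariant_sets (R : realType) (P : probability (Borel (mstar R)) R) :
    set (set (Borel (mstar R))) :=
  [set A : set (Borel (mstar R)) |
    measurable A /\ P.-negligible (A `+` (tmap_preimage A : set (Borel (mstar R))))].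

(* Main.v *)
Require Import Defs.
From HB Require Import structures.
From mathcomp Require Import all_boot all_order all_algebra.
From mathcomp Require Import all_classical all_reals all_analysis.
From mathcomp Require Import measurable_realfun ring lra.

Set Implicit Arguments.
Unset Strict Implicit.
Unset Printing Implicit Defensive.

Import Order.TTheory GRing.Theory Num.Theory.
Import numFieldNormedType.Exports.

Local Open Scope classical_set_scope.
Local Open Scope ring_scope.

(** Write [m_k] for the mass of [[k, k + 1)] and [t_k nu] for the normalized
    translate of [nu] by the integer [k].  Along the orbit of the return map, the
    weights [m_k] are the Radon-Nikodym cocycle of the law of [nu], so that the
    statement is a ratio ergodic theorem of Hurewicz type.  The proof obtains the
    inequalities it needs from the ancestors of [[0, 1)] in the [p]-adic scales,
    where only finitely many cells are involved.

    The last [n] digits of the past say which of the [p ^ n] cells of its ancestor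
    of level [n] is [[0, 1)]; [offset n] is the number of that cell.  Invariance and
    adaptedness give [block_formula]: the pair made of the offset and of the measure
    has the law of [(l, zoom n l nu')], where [nu'] follows the law of the process
    and the cell [l] of [[0, 1)] is then picked with probability its mass under
    [nu'].  The zooms into two charged cells of the same measure are integer
    translates of each other ([tstar_zoom]), hence statements on the orbit of [nu]
    reduce to statements on finite sequences of cells.

    Since the process is ergodic and not deterministic, infinitely many digits have
    a conditional probability bounded away from 1, so the mass of the ancestors
    tends to infinity.  The place of [[0, 1)] inside its ancestor is chosen according
    to mass, so a fixed fraction of that mass is likely to lie to the right of the
    origin; hence the ancestors exhaust the half-line and it has infinite mass
    ([right_mass_unbounded], [mass_unbounded]).

    Two facts then pass from the ancestors to the half-line: the charged translates
    of almost every measure avoid a given null set ([tstar_nonsingular]), and the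
    elementary rising-sun inequality for finite sequences becomes a maximal
    inequality ([half_line_maximal_inequality]).

    To conclude, let [g] be the conditional expectation of [f], and [h = f - g].  The
    function [g] is constant on the charged translates of almost every measure, so it
    suffices to see that the averages of [h] tend to 0.  For [e > 0], the set of
    measures for which the sums of [m_k * (h (t_k nu) - e)] are unbounded above is
    invariant: [h] has integral 0 on it, whereas the maximal inequality makes the
    integral of [h - e] nonnegative.  So it is a null set ([weighted_sum_negligible]),
    and off it the sums of [m_k * h (t_k nu)] up to [N] are at most
    [e * nu [0, N)] plus a constant.  The same applies to [- h].

    The measurability of the maps involved uses only the second countability of the
    real line and of the space of digit sequences: a Borel function of a measure is
    fed into the rescaling [(c, nu) |-> c nu], which is jointly continuous. *)

(** * Existence of conditional expectations *)

Section conditional_expectation.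
Context d {T : measurableType d} {R : realType} (P : probability T R).
Variable G : set (set T).
Hypotheses (sG : sigma_algebra setT G) (GT : G `<=` measurable).

Let id_ : T -> g_sigma_algebraType G := id.

Let mG (A : set T) : (G.-sigma.-measurable (A : set (g_sigma_algebraType G))) = G A.
Proof. by rewrite measurable_g_measurableTypeE. Qed.

Let mid : measurable_fun [set: T] id_.
Proof. by move=> _ A; rewrite mG setTI => /GT. Qed.

(** Radon-Nikodym on the sub-sigma-algebra [G], for the charge of density [f] and
    the probability, both restricted to [G]: the restriction is the image by the
    identity map onto [T] equipped with [G]. *)
Lemma condexp_exists (f : T -> R) : P.-integrable setT (EFin \o f) ->
  exists g, is_condexp P G f g.
Proof.
move=> intf.
pose id1 : {mfun T >-> g_sigma_algebraType G} :=
  HB.pack id_ (isMeasurableFun.Build _ _ _ _ id_ mid).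
pose P1 := distribution P id1.
pose nu : {charge set T -> \bar R} := induced_charge intf.
pose nu1 : {charge set (g_sigma_algebraType G) -> \bar R} :=
  measure_function_pushforward__canonical__charge_Charge nu mid.
have nuP : nu `<< P.
  apply/null_content_dominatesP => A mA PA.
  rewrite /nu/= /induced_charge; apply: null_set_integral => //.
  by apply: measurable_funTS; exact: measurable_int intf.
have nu1P1 : nu1 `<< P1 := dominates_pushforward mid nuP.
pose h := Radon_Nikodym nu1 P1.
have hfin x : h x \is a fin_num by exact: Radon_Nikodym_fin_num.
have hint : P1.-integrable setT h by exact: Radon_Nikodym_integrable.
have mh : measurable_fun setT h by exact: measurable_int hint.
have hE : EFin \o (fine \o h) = h by apply/funext => x /=; rewrite fineK.
have hintP : P.-integrable setT (h \o id1).
  apply/integrableP; split; first exact: measurableT_comp.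
  have /integrableP[_] := hint.
  by rewrite ge0_integral_distribution//; exact: measurableT_comp.
exists (fine \o h); split.
- move=> B mB; rewrite -mG -[X in measurable X]setTI.
  have mfh : measurable_fun setT (fine \o h) by exact: measurableT_comp.
  exact: mfh.
- by rewrite hE.
- move=> A GA.
  have mA : measurable (A : set (g_sigma_algebraType G)) by rewrite mG.
  have := @Radon_Nikodym_integral _ _ _ nu1 P1 A nu1P1 mA.
  have <- : (\int[P]_(x in A) (h \o id1) x)%E = (\int[P1]_(x in A) h x)%E.
    rewrite (@integral_pushforward _ _ _ _ _ id1)//.
    by apply: integrableS hintP => //; exact: GT.
  move=> nuE; rewrite [RHS](_ : _ = nu1 A)// nuE.
  by apply: eq_integral => x _ /=; rewrite fineK.
Qed.

Lemma condexpP (f : T -> R) : P.-integrable setT (EFin \o f) ->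
  is_condexp P G f (condexp P G f).
Proof.
by move=> /condexp_exists[g gP]; rewrite /condexp; case: xgetP => [y _ //|/(_ g)].
Qed.

End conditional_expectation.

(** * Borel maps between topological spaces *)

(** The index set carries no topology here, as is the case of the set of test
    functions. *)
Lemma cvg_ptwsP (I : Type) (T : topologicalType) (F : set_system (I -> T)) (f : I -> T) :
  Filter F -> {ptws, F --> f} <-> forall i, g i @[g --> F] --> f i.
Proof.
move=> FF; split => [/cvg_sup Ff i A|Ff].
  rewrite nbhsE => -[B [oB Bf] BA].
  have := Ff i; apply; exists ((fun g : I -> T => g i) @^-1` B).
  by split => [||g /BA//]; first by exists B.
apply/cvg_sup => i A [_ [[B oB <-] Bf] BA].
apply: filterS BA _; apply: (Ff i).
exact: open_nbhs_nbhs.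
Qed.

Section borel_maps.

Lemma borel_open (T : ptopologicalType) (U : set T) : open U -> measurable (U : set (Borel T)).
Proof. exact: sub_sigma_algebra. Qed.

Lemma measurable_to_borel d (T : measurableType d) (U : ptopologicalType) (u : T -> Borel U) :
  (forall V : set U, open V -> measurable (u @^-1` V)) -> measurable_fun [set: T] u.
Proof.
move=> mV; apply: (@measurability _ _ T (Borel U) _ _ (@open U)) => // _ [V oV <-].
by rewrite setTI; exact: mV.
Qed.

Lemma continuous_borel (T U : ptopologicalType) (u : T -> U) :
  continuous u -> measurable_fun [set: Borel T] (u : Borel T -> Borel U).
Proof.
move=> /continuousP cu; apply: measurable_to_borel => V oV.
by apply: borel_open; exact: cu.
Qed.

Lemma continuous_borelR (R : realType) (T : ptopologicalType) (u : T -> R) :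
  continuous u -> measurable_fun [set: Borel T] (u : Borel T -> R).
Proof.
move=> /continuousP cu; apply: (measurability _ (RGenOpens.measurableE R)).
move=> _ [_ [a [b ->] <-]]; rewrite setTI.
by apply: borel_open; apply: cu; exact: interval_open.
Qed.

(** Only the first factor has to be second countable: around a point of [W], the
    first coordinate can be enclosed in a rational interval whose product with a
    neighbourhood of the second one is contained in [W]. *)
Lemma open_pair_measurable (R : realType) d (T : measurableType d) (X : topologicalType)
    (W : set (R * X)) (s : T -> R) (u : T -> X) : open W ->
  measurable_fun [set: T] s -> (forall V, open V -> measurable (u @^-1` V)) ->
  measurable [set t | W (s t, u t)].
Proof.
move=> oW ms mu.
pose V (q : rat * rat) : set X :=
  [set x | forall c : R, ratr q.1 < c < ratr q.2 -> W (c, x)]°.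
rewrite (_ : [set _ | _] =
    \bigcup_q (s @^-1` `]ratr q.1, ratr q.2[%classic `&` u @^-1` (V q))).
  apply: countable_bigcupT_measurable => // q.
  apply: measurableI; last exact/mu/open_interior.
  by rewrite -[X in measurable X]setTI; exact: ms.
apply/seteqP; split => [t /= Wt|t [q _ [/= sq Vq]]]; last first.
  by apply: (interior_subset Vq); move: sq; rewrite in_itv.
have [[A B] /= [At Bt] AB] : nbhs (s t, u t) W by exact: open_nbhs_nbhs.
have [e /= e0 eA] := At.
have [|q1 q1P] := @rat_in_itvoo _ (s t - e) (s t); first by rewrite ltrBlDr ltrDl.
have [|q2 q2P] := @rat_in_itvoo _ (s t) (s t + e); first by rewrite ltrDl.
move: q1P q2P; rewrite !in_itv/= => /andP[q1a q1b] /andP[q2a q2b].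
exists (q1, q2) => //; split; first by rewrite /= in_itv/= q1b.
apply: filterS Bt => x Bx c /= /andP[q1c cq2].
apply: (AB (c, x)); split => //=; apply: eA => /=.
rewrite ltr_distlC (lt_trans q1a q1c)/=; exact: lt_trans cq2 q2b.
Qed.
End borel_maps.

(** * Masses of intervals as Borel functions *)

Section radon_topology.
Context {R : realType}.

Definition clamp (t : R) : R := Num.max 0 (Num.min 1 t).

Lemma clamp_continuous : continuous clamp.
Proof.
move=> t; apply: (@continuous_max R R (cst 0) (fun t => Num.min 1 t)).
  exact: cst_continuous.
apply: (@continuous_min R R (cst 1) id); [exact: cst_continuous|exact: cvg_id].
Qed.

Lemma clamp_eq1 t : 1 <= t -> clamp t = 1.
Proof. by move=> t1; rewrite /clamp (min_idPl t1) max_r. Qed.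

Lemma clamp_eq0 t : t <= 0 -> clamp t = 0.
Proof. by move=> t0; rewrite /clamp min_r ?(le_trans t0)// max_l. Qed.

(** Trapezoids that tend pointwise to the indicator of [[a, b)]: the left slope reaches
    1 at [a] and the right one reaches 0 at [b], whence a half-open interval. *)
Definition ramp (a b : R) (n : nat) (x : R) : R :=
  Num.min (clamp (n.+1%:R * (x - a) + 1)) (clamp (n.+1%:R * (b - x))).

Lemma ramp_continuous a b n : continuous (ramp a b n).
Proof.
move=> x; apply: (@continuous_min R R (fun x => clamp (n.+1%:R * (x - a) + 1))
  (fun x => clamp (n.+1%:R * (b - x)))).
  apply: continuous_comp; last exact: clamp_continuous.
  apply: cvgD; last exact: cvg_cst.
  by apply: cvgM; [exact: cvg_cst|apply: cvgB; [exact: cvg_id|exact: cvg_cst]].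
apply: continuous_comp; last exact: clamp_continuous.
by apply: cvgM; [exact: cvg_cst|apply: cvgB; [exact: cvg_cst|exact: cvg_id]].
Qed.

Lemma ramp_ge0 a b n x : 0 <= ramp a b n x.
Proof. by rewrite /ramp le_min /clamp !le_max !lexx. Qed.

Lemma ramp_le1 a b n x : ramp a b n x <= 1.
Proof. by rewrite /ramp ge_min /clamp !ge_max !ler01 !ge_min !lexx. Qed.

Lemma ramp_eq0l a b n x : n.+1%:R * (x - a) + 1 <= 0 -> ramp a b n x = 0.
Proof. by move=> h; rewrite /ramp clamp_eq0// min_l// /clamp le_max lexx. Qed.

Lemma ramp_eq0r a b n x : b <= x -> ramp a b n x = 0.
Proof.
move=> h; rewrite /ramp [X in Num.min _ X]clamp_eq0 ?pmulr_rle0 ?subr_le0//.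
by rewrite min_r// /clamp le_max lexx.
Qed.

Lemma ramp_out a b n x : x \notin `[a - 1, b] -> ramp a b n x = 0.
Proof.
rewrite in_itv/= negb_and -!ltNge => /orP[h|/ltW]; last exact: ramp_eq0r.
apply: ramp_eq0l; rewrite -lerBrDr sub0r.
apply: (@le_trans _ _ (n.+1%:R * (- 1))).
  by rewrite ler_pM2l// lerBlDr addrC ltW.
by rewrite mulrN1 lerN2 ler1n.
Qed.

Lemma ramp_compact a b n : compact (closure [set x | ramp a b n x != 0]).
Proof.
apply: (@subclosed_compact _ _ `[a - 1, b]).
- exact: closed_closure.
- exact: segment_compact.
- rewrite closureE; apply: smallest_sub; first exact: itv_closed.
  move=> x /= /eqP r0; apply: contrapT => /negP xab.
  exact/r0/ramp_out.
Qed.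

Definition ramp_Cc a b n : Cc R :=
  exist _ (ramp a b n) (conj (@ramp_continuous a b n) (@ramp_compact a b n)).

Lemma ramp_cvg a b x : ramp a b ^~ x @ \oo --> (\1_(`[a, b[%classic) x : R).
Proof.
apply: cvg_near_cst; rewrite indicE.
have [ax|xa] := leP a x; last first.
  rewrite memNset/=; last by rewrite in_itv/= leNgt xa.
  near=> n; apply: ramp_eq0l.
  rewrite -lerBrDr sub0r -lerN2 opprK -mulrN opprB -ler_pdivrMr ?subr_gt0//.
  apply: (@le_trans _ _ n%:R); last by rewrite ler_nat.
  by near: n; exact: nbhs_infty_ger.
have [xb|bx] := ltP x b; last first.
  rewrite memNset/=; last by rewrite in_itv/= ltNge bx andbF.
  by near=> n; apply: ramp_eq0r.
rewrite mem_set/=; last by rewrite in_itv/= ax xb.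
near=> n.
rewrite /ramp !clamp_eq1 ?minxx//.
  rewrite -ler_pdivrMr ?subr_gt0//.
  apply: (@le_trans _ _ n%:R); last by rewrite ler_nat.
  by near: n; exact: nbhs_infty_ger.
by rewrite lerDr mulr_ge0// subr_ge0.
Unshelve. all: by end_near. Qed.

Lemma Cc_integral_continuous (f : Cc R) :
  continuous (fun nu : radon R => Cc_integral nu f).
Proof.
move=> nu.
have : {ptws, (@Cc_integral R) @ nu --> Cc_integral nu} :=
    @initial_continuous _ _ (@Cc_integral R) nu.
move=> h; have F0 : Filter (nbhs (nu : radon R)) by exact: nbhs_filter.
have [+ _] := @cvg_ptwsP (Cc R) R (Cc_integral @ nu) (Cc_integral nu) (fmap_filter _ F0).
by move=> /(_ h f).
Qed.

Lemma itv_co_fin (nu : radon R) a b : nu `[a, b[%classic \is a fin_num.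
Proof.
rewrite ge0_fin_numE//; apply: le_lt_trans (radon_finite nu (@segment_compact _ a b)).
apply: le_measure; rewrite ?inE//=; apply: subset_itvl.
by rewrite bnd_simp.
Qed.

(** Dominated convergence, all the trapezoids being supported in [[a - 1, b]]. *)
Lemma ramp_cvg_measure (nu : radon R) a b :
  ((Cc_integral nu (ramp_Cc a b n))%:E @[n --> \oo] --> nu `[a, b[%classic)%E.
Proof.
have mr n : measurable_fun [set: R] (EFin \o ramp a b n).
  apply/measurable_EFinP; apply: continuous_measurable_fun.
  exact: ramp_continuous.
pose box : set R := `[a - 1, b]%classic.
have mbox : measurable box by exact: measurable_itv.
have intb : nu.-integrable setT (EFin \o \1_(box)).
  apply/integrableP; split; first by apply/measurable_EFinP; exact: measurable_indic.
  rewrite (eq_integral (EFin \o \1_(box))); last first.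
    by move=> x _ /=; rewrite ger0_norm// indicE.
  rewrite integral_indic// setIT; apply: radon_finite.
  exact: segment_compact.
have bnd n x : (`|(ramp a b n x)%:E| <= (EFin \o \1_(box)) x)%E.
  rewrite /= lee_fin ger0_norm ?ramp_ge0// indicE.
  case: (boolP (x \in _)) => [_|]; first exact: ramp_le1.
  by rewrite notin_setE /box/= => /negP/ramp_out ->.
have [] := @dominated_convergence _ _ _ nu setT measurableT
  (fun n => EFin \o ramp a b n) (EFin \o \1_(`[a, b[%classic)) _ mr _ _ intb.
- by apply/measurable_EFinP; exact: measurable_indic.
- by apply: aeW => x _; apply: cvg_EFin; [exact: nearW|exact: ramp_cvg].
- by apply: aeW => x n _; exact: bnd.
move=> _ _.
rewrite integral_indic// setIT => H; apply: cvg_trans H; apply: near_eq_cvg.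
near=> n; rewrite /Cc_integral /Rintegral fineK//.
apply: integrable_fin_num => //; apply: (le_integrable _ (mr n) _ intb) => //.
by move=> x xT; rewrite [leRHS]gee0_abs ?lee_fin//; exact: bnd.
Unshelve. all: by end_near. Qed.

Lemma measurable_itv_co a b :
  measurable_fun [set: Borel (radon R)] (fun nu : radon R => nu `[a, b[%classic).
Proof.
apply: (@emeasurable_fun_cvg _ (Borel (radon R)) R setT
  (fun n (nu : Borel (radon R)) => (Cc_integral nu (ramp_Cc a b n))%:E)).
  move=> n; apply/measurable_EFinP; apply: continuous_borelR.
  exact: Cc_integral_continuous.
by move=> nu _; exact: ramp_cvg_measure.
Qed.

End radon_topology.

(** * Image measures, rescaling and normalization *)

Section radon_maps.
Context {R : realType}.

Lemma Cc_integrable (nu : radon R) (f : Cc R) : nu.-integrable setT (EFin \o sval f).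
Proof.
case: f => f [cf kf] /=.
set K := closure _ in kf.
have mf : measurable_fun setT (EFin \o f).
  by apply/measurable_EFinP; exact: continuous_measurable_fun.
have mK : measurable K by exact: compact_measurable.
have [M [_ Mf]] : bounded_set (f @` K).
  apply: compact_bounded; apply: continuous_compact => //.
  exact: continuous_subspaceT.
have intK : nu.-integrable setT (EFin \o (fun x => `|M + 1| * \1_K x)).
  apply: (@eq_integrable _ _ _ _ _ measurableT (fun x => (`|M + 1|)%:E * (\1_K x)%:E)%E) => //.
  apply: integrableZl => //; apply/integrableP; split.
    by apply/measurable_EFinP; exact: measurable_indic.
  rewrite (eq_integral (EFin \o \1_K)); last by move=> x _ /=; rewrite ger0_norm// indicE.
  by rewrite integral_indic// setIT; exact: radon_finite.
apply: (le_integrable _ mf _ intK) => // x _ /=; rewrite lee_fin.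
rewrite [leRHS]ger0_norm ?mulr_ge0 ?indicE//.
have [xK|xK] := boolP (x \in K).
  rewrite mulr1; apply: (Mf `|M + 1|); last by exists x => //; exact: set_mem.
  by apply: lt_le_trans (ler_norm _); rewrite ltrDl.
rewrite mulr0 (_ : f x = 0) ?normr0//.
apply: contrapT => /eqP fx; move: xK; rewrite notin_setE; apply.
exact: subset_closure.
Qed.

Lemma radon_continuous (X : topologicalType) (u : X -> radon R) :
  (forall f : Cc R, continuous (fun x => Cc_integral (u x) f)) -> continuous u.
Proof.
move=> cu; apply: (@continuous_comp_initial (radon R) X _ (@Cc_integral R) u).
move=> x; have F0 : Filter (nbhs x) by exact: nbhs_filter.
have [_ h] := @cvg_ptwsP (Cc R) R ((@Cc_integral R \o u) @ x) (Cc_integral (u x))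
  (fmap_filter _ F0).
by apply: h => f; exact: cu.
Qed.

Lemma integral_mk_radon (m : {measure set R -> \bar R})
    (mf : forall K : set R, compact K -> (m K < +oo)%E) (f : R -> \bar R) :
  (\int[mk_radon mf]_x f x = \int[m]_x f x)%E.
Proof.
by apply: eq_measure_integral => A mA _; rewrite /= borel_partE.
Qed.

Section push.
Variables (phi : R -> R) (cphi : continuous phi).
Hypothesis pphi : forall K : set R, compact K -> compact (phi @^-1` K).

Lemma pushE (nu : radon R) (A : set R) :
  measurable A -> push cphi pphi nu A = nu (phi @^-1` A).
Proof. by move=> mA; rewrite /= borel_partE. Qed.

Lemma Cc_comp_subproof (f : Cc R) :
  continuous (sval f \o phi) /\ compact (closure [set x | (sval f \o phi) x != 0]).
Proof.
case: f => f [cf kf] /=; split.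
  by move=> x; apply: continuous_comp; [exact: cphi|exact: cf].
apply: (@subclosed_compact _ _ (phi @^-1` closure [set x | f x != 0]));
  first exact: closed_closure.
  exact: pphi.
rewrite closureE; apply: smallest_sub.
  by apply: closed_comp => [x _|]; [exact: cphi|exact: closed_closure].
by move=> x fx; exact: subset_closure.
Qed.

Definition Cc_comp (f : Cc R) : Cc R := exist _ (sval f \o phi) (Cc_comp_subproof f).

Lemma Cc_integral_push (nu : radon R) (f : Cc R) :
  Cc_integral (push cphi pphi nu) f = Cc_integral nu (Cc_comp f).
Proof.
have mphi : measurable_fun setT phi by exact: continuous_measurable_fun.
have mf : measurable_fun setT (EFin \o sval f).
  by apply: measurable_int (Cc_integrable nu f).
rewrite /Cc_integral /Rintegral integral_mk_radon; congr fine.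
have <- := @integral_pushforward _ _ _ _ R phi mphi nu setT _ mf
  (Cc_integrable nu (Cc_comp f)) measurableT.
exact: eq_measure_integral.
Qed.

Lemma push_continuous : continuous (push cphi pphi : radon R -> radon R).
Proof.
apply: radon_continuous => f.
rewrite (_ : (fun _ => _) = (fun nu => Cc_integral nu (Cc_comp f))).
  exact: Cc_integral_continuous.
by apply/funext => nu; exact: Cc_integral_push.
Qed.

End push.

Lemma max0_ge0 (c : R) : 0 <= Num.max 0 c.
Proof. by rewrite le_max lexx. Qed.

(** Rescaling as a function of a real factor, the negative factors being replaced
    by 0; this makes joint continuity in the factor and the measure meaningful. *)
Definition rescale (x : R * radon R) : radon R := scale (NngNum (max0_ge0 x.1)) x.2.

Lemma scaleE (c : {nonneg R}) (nu : radon R) (A : set R) :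
  measurable A -> scale c nu A = (c%:num%:E * nu A)%E.
Proof. by move=> mA; rewrite /= borel_partE. Qed.

Lemma Cc_integral_scale (c : {nonneg R}) (nu : radon R) (f : Cc R) :
  Cc_integral (scale c nu) f = c%:num * Cc_integral nu f.
Proof.
have intf := Cc_integrable nu f.
have mf : measurable_fun setT (EFin \o sval f) by exact: measurable_int intf.
have E : (\int[mscale c nu]_x (EFin \o sval f) x =
    c%:num%:E * \int[nu]_x (EFin \o sval f) x)%E.
  rewrite integralE (ge0_integral_mscale _ _ _ (measurable_funepos mf))//.
  rewrite (ge0_integral_mscale _ _ _ (measurable_funeneg mf))//.
  rewrite [in RHS]integralE [RHS]muleBr// fin_num_adde_defr// integrable_fin_num//.
  exact: integrable_funepos.
by rewrite /Cc_integral /Rintegral integral_mk_radon E fineM// integrable_fin_num.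
Qed.

Lemma rescale_continuous : continuous rescale.
Proof.
apply: radon_continuous => f.
rewrite (_ : (fun _ => _) = (fun x : R * radon R => Num.max 0 x.1 * Cc_integral x.2 f)).
  move=> x; apply: cvgM.
    apply: (@continuous_max R (R * radon R)%type (cst 0) fst); first exact: cst_continuous.
    exact: cvg_fst.
  apply: (@continuous_comp _ _ _ snd (fun nu => Cc_integral nu f)).
    exact: cvg_snd.
  exact: Cc_integral_continuous.
by apply/funext => x; rewrite Cc_integral_scale.
Qed.

Lemma normalize_rescale (nu : radon R) :
  normalize nu = rescale ((normalizer nu)%:num^-1, nu).
Proof.
apply: radon_eq => A mA; rewrite /normalize /rescale !scaleE//=.
by rewrite max_r// invr_ge0 fine_ge0.
Qed.

End radon_maps.

Section min_nat.

Lemma min_natP (P : set nat) : P !=set0 ->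
  P (min_nat P) /\ forall m, P m -> (min_nat P <= m)%N.
Proof.
move=> [n Pn]; rewrite /min_nat.
have exP : exists n, `[< P n >] by exists n; apply/asboolP.
case: xgetP => [m _ //|/(_ (ex_minn exP))]; case: ex_minnP => m /asboolP Pm mP [].
by split => // k Pk; apply: mP; apply/asboolP.
Qed.

Lemma min_nat_eq (P : set nat) n : P n -> (forall m, P m -> (n <= m)%N) -> min_nat P = n.
Proof.
move=> Pn nP; have [Pm mP] := @min_natP P (ex_intro _ n Pn).
by apply/eqP; rewrite eqn_leq nP// mP.
Qed.

Lemma measurable_min_nat d (T : measurableType d) (P : T -> set nat) n :
  (forall k, measurable [set t | P t k]) -> measurable [set t | min_nat (P t) = n].
Proof.
move=> mP.
pose first k := [set t | P t k] `&` \bigcap_(m in [set m | (m < k)%N]) ~` [set t | P t m].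
pose none := \bigcap_m ~` [set t | P t m].
have mfirst k : measurable (first k).
  by apply: measurableI => //; apply: bigcap_measurableType => m _; exact: measurableC.
have mnone : measurable none.
  by apply: bigcap_measurableType => m _; exact: measurableC.
rewrite (_ : [set _ | _] = first n `|` (if n == 0%N then none else set0)).
  by apply: measurableU => //; case: ifP.
apply/seteqP; split => t /=.
  have [P0 <-|nP] := pselect (P t !=set0).
    have [Pt Pm] := min_natP P0; left; split => // m /= mP' Pm'.
    by move: (Pm _ Pm'); rewrite leqNgt mP'.
  have none_t : none t by move=> m _ /= Pm; apply: nP; exists m.
  move=> n0; right; rewrite -n0 /min_nat.
  case: xgetP => [m _ [Pm _]|_]; last by rewrite eqxx.
  by case: (none_t m).
move=> [[/= Pn nP]|].
  apply: min_nat_eq => // m Pm; rewrite leqNgt; apply/negP => mn.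
  exact: nP Pm.
case: ifP => // /eqP -> none_t; rewrite /min_nat; case: xgetP => // m _ [Pm _].
by case: (none_t m).
Qed.

Lemma measurable_nat_index d d' (T : measurableType d) (U : measurableType d')
    (k : T -> nat) (h : nat -> T -> U) :
  (forall n, measurable [set t | k t = n]) -> (forall n, measurable_fun setT (h n)) ->
  measurable_fun setT (fun t => h (k t) t).
Proof.
move=> mk mh _ A mA; rewrite setTI.
rewrite (_ : _ @^-1` _ = \bigcup_n ([set t | k t = n] `&` h n @^-1` A)).
  apply: bigcupT_measurable => n; apply: measurableI => //.
  by rewrite -[X in measurable X]setTI; exact: mh.
by apply/seteqP; split => [t /= At|t [n _ [/= <-]]//]; exists (k t).
Qed.

End min_nat.

Section normalization.
Context {R : realType}.

Lemma measurable_invr : measurable_fun [set: R] (@GRing.inv R).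
Proof.
rewrite -(setUv [set 0%R]); apply/measurable_funU => //; first exact: measurableC.
split; first exact: measurable_fun_set1.
apply: open_continuous_measurable_fun; first by apply: closed_openC; exact: closed_eq.
by move=> x; rewrite inE/= => /eqP; exact: inv_continuous.
Qed.

Lemma measurable_normalizer :
  measurable_fun [set: Borel (radon R)] (fun nu : radon R => (normalizer nu)%:num).
Proof.
apply: (@measurable_nat_index _ _ (Borel (radon R)) R (fun nu : radon R => psi nu)
  (fun n (nu : radon R) => fine (nu (window n)))) => n.
  apply: (@measurable_min_nat _ (Borel (radon R))) => k.
  rewrite (_ : [set _ | _] = if (1 <= k)%N then
      (fun nu : radon R => nu (window k)) @^-1` `]0%E, +oo[%classic else set0).
    case: ifP => // _; rewrite -[X in measurable X]setTI.
    by apply: (@measurable_itv_co R (- (k%:R - 1)) k%:R) => //; exact: emeasurable_itv.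
  apply/seteqP; split => nu /=; first by move=> [-> /=]; rewrite in_itv/= andbT.
  by case: ifP => //=; rewrite in_itv/= andbT.
by apply: measurableT_comp => //; exact: measurable_itv_co.
Qed.

(** The normalizer is only Borel, but the normalized measure is a jointly
    continuous function of the normalizer and of the measure. *)
Lemma measurable_nrm :
  measurable_fun [set: Borel (radon R)] (@nrm R : Borel (radon R) -> Borel (mstar R)).
Proof.
apply: measurable_to_borel => _ [V oV <-].
rewrite (_ : _ @^-1` _ = [set nu : Borel (radon R) |
    (rescale @^-1` V) ((normalizer nu)%:num^-1, nu)]).
  apply: (@open_pair_measurable R _ (Borel (radon R)) (radon R) (rescale @^-1` V)
    (fun nu : radon R => (normalizer nu)%:num^-1) id).
  - by move: V oV; apply/continuousP; exact: rescale_continuous.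
  - exact: measurableT_comp measurable_invr measurable_normalizer.
  - by move=> W oW; exact: borel_open.
by apply/seteqP; split => nu /=; rewrite -normalize_rescale.
Qed.

Lemma measurable_tstar x :
  measurable_fun [set: Borel (mstar R)] (tstar x : Borel (mstar R) -> Borel (mstar R)).
Proof.
apply: (measurableT_comp measurable_nrm).
apply: (@continuous_borel (mstar R) (radon R)) => nu.
apply: (@continuous_comp _ _ _ radon_of (translate x)); last exact: push_continuous.
exact: initial_continuous.
Qed.

Lemma measurable_zoom_digit p (hp : (2 <= p)%N) (j : digit hp) :
  measurable_fun [set: Borel (mstar R)]
    ((fun nu : mstar R => nrm (push_rho j nu)) : Borel (mstar R) -> Borel (mstar R)).
Proof.
apply: (measurableT_comp measurable_nrm).
apply: (@continuous_borel (mstar R) (radon R)) => nu.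
apply: (@continuous_comp _ _ _ radon_of (push_rho j)); last exact: push_continuous.
exact: initial_continuous.
Qed.

Lemma measurable_mass a b : measurable_fun [set: Borel (mstar R)]
  ((fun nu : mstar R => nu `[a, b[%classic) : Borel (mstar R) -> \bar R).
Proof.
apply: (@measurableT_comp _ _ _ (Borel (mstar R)) (Borel (radon R)) _
  (fun nu : radon R => nu `[a, b[%classic) _ radon_of).
  exact: measurable_itv_co.
by apply: (@continuous_borel (mstar R) (radon R)) => nu; exact: initial_continuous.
Qed.

End normalization.

(** * The phase space and its past *)

Section phase_space.
Context {R : realType} (p : nat) (hp : (2 <= p)%N).

Lemma measurable_hati (n : int) (j : digit hp) :
  measurable ([set x | hati n x = j] : set (Borel (phase R hp))).
Proof.
apply: borel_open.
have cn : continuous (fun x : phase R hp => x.2 n : digit hp).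
  move=> x; have [+ _] := @cvg_ptwsP int (digit hp) (snd @ x) x.2
    (fmap_filter _ (nbhs_filter x)).
  by apply; exact: cvg_snd.
rewrite (_ : [set _ | _] = (fun x : phase R hp => x.2 n) @^-1` [set j]); last by [].
by apply: open_comp => //; exact: (@discrete_open (discrete_topology 'I_p)).
Qed.

Definition cylinder (c : nat * seq 'I_p * seq 'I_p) : set (int -> digit hp) :=
  [set i | forall k, (k < c.1.1)%N ->
    i k%:Z = nth (Ordinal (ltnW hp)) c.1.2 k /\
    i (- k%:Z) = nth (Ordinal (ltnW hp)) c.2 k].

(** Otherwise there would be, for every [m], a sequence outside the neighbourhood
    that agrees with [i] on the indices of absolute value less than [m]; these
    sequences converge pointwise to [i]. *)
Lemma nbhs_cylinder (i : {ptws int -> digit hp}) (B : set {ptws int -> digit hp}) :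
  nbhs i B -> exists c, cylinder c i /\ cylinder c `<=` B.
Proof.
move=> Bi.
pose c m := (m, mkseq (fun k => i k%:Z) m, mkseq (fun k => i (- k%:Z)) m).
have ci m : cylinder (c m) i by move=> k /= km; rewrite !nth_mkseq.
have [[m cB]|nB] := pselect (exists m, cylinder (c m) `<=` B); first by exists (c m).
have /choice[s sP] m : exists s, cylinder (c m) s /\ ~ B s.
  have /existsNP[s /not_implyP sP] : ~ (cylinder (c m) `<=` B) by move=> ?; apply: nB; exists m.
  by exists s.
have [_ h] := @cvg_ptwsP int (digit hp) (s @ \oo) i _.
have {}h : {ptws, s @ \oo --> i}.
  apply: h => n; apply: cvg_near_cst.
  exists `|n|.+1 => //= m /= nm.
  have [sm _] := sP m.
  by case: n nm => k nm; have := sm _ nm; rewrite /= !nth_mkseq// => -[].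
have : (s @ \oo) B := h _ Bi.
by move=> [m _ /(_ m (leqnn m)) sB]; case: (sP m).
Qed.

(** An open set of the phase space is the union, over the countably many cylinders,
    of the largest open rectangles over these cylinders that it contains. *)
Lemma measurable_to_phase d (T : measurableType d) (u : T -> Borel (phase R hp)) :
  measurable_fun setT (hatnu \o u) -> (forall n j, measurable [set t | hati n (u t) = j]) ->
  measurable_fun setT u.
Proof.
move=> mu1 mu2; apply: measurable_to_borel => W oW.
pose V c : set (mstar R) := [set nu | forall i, cylinder c i -> W (nu, i)]°.
rewrite (_ : _ @^-1` _ =
    \bigcup_c ([set t | V c (hatnu (u t))] `&` [set t | cylinder c (u t).2])).
  apply: countable_bigcupT_measurable => // c; apply: measurableI.
    rewrite -[X in measurable X]setTI; apply: mu1 => //.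
    by apply: borel_open; exact: open_interior.
  rewrite (_ : [set _ | _] = \bigcap_(k in [set k | (k < c.1.1)%N])
     ([set t | hati k%:Z (u t) = nth (Ordinal (ltnW hp)) c.1.2 k] `&`
      [set t | hati (- k%:Z) (u t) = nth (Ordinal (ltnW hp)) c.2 k])) //.
  by apply: bigcap_measurableType => k _; apply: measurableI; exact: mu2.
apply/seteqP; split => [t /= Wt|t [c _ [/= Vt ct]]]; last first.
  have /(_ _ ct) := interior_subset Vt.
  by rewrite /hatnu; case: (u t).
have [[A B] /= [At Bt] AB] : nbhs (u t) W by exact: open_nbhs_nbhs.
have [c [ct cB]] := nbhs_cylinder Bt.
exists c => //; split => //=.
apply: filterS At => nu Anu i /cB Bi.
exact: (AB (nu, i)).
Qed.

Lemma bigcup_digit_measurable d (T : measurableType d) (F : digit hp -> set T) :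
  (forall j, measurable (F j)) -> measurable (\bigcup_j F j).
Proof. by apply: countable_bigcupT_measurable; exact: (@countableP 'I_p). Qed.

Lemma measurable_M_p : measurable_fun setT (@M_p R p hp).
Proof.
apply: measurable_to_phase => [_ A mA|n j]; last exact: (measurable_hati (n + 1)).
rewrite setTI (_ : _ @^-1` _ = \bigcup_(j : digit hp) ([set x | hati 1 x = j] `&`
    ((fun nu : mstar R => nrm (push_rho j nu)) \o hatnu) @^-1` A)).
  apply: bigcup_digit_measurable => j; apply: measurableI; first exact: measurable_hati.
  rewrite -[X in measurable X]setTI.
  by apply: (measurableT_comp (measurable_zoom_digit j) (@measurable_hatnu R p hp)).
by apply/seteqP; split => [x /= Ax|x [j _ [/= <-]]//]; exists (hati 1 x).
Qed.

HB.instance Definition _ :=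
  isMeasurableFun.Build _ _ _ _ (@M_p R p hp) measurable_M_p.

(** Named so that the past is the family of measurable sets of
    [g_sigma_algebraType past_gen]. *)
Definition past_gen : set (set (Borel (phase R hp))) :=
  [set A | (exists2 B, measurable B & A = hatnu @^-1` B) \/
           (exists n j, n <= 0 /\ A = [set x | hati n x = j])].

Lemma past_sigma : sigma_algebra setT (@past R p hp).
Proof. exact: smallest_sigma_algebra. Qed.

Lemma past_measurable : @past R p hp `<=` measurable.
Proof.
apply: smallest_sub; first exact: sigma_algebra_measurable.
move=> A [[B mB ->]|[n [j [_ ->]]]]; last exact: measurable_hati.
by rewrite -[X in measurable X]setTI; exact: measurable_hatnu.
Qed.

(** The last [n] digits of the past, read in base [p]: the parent of [[0, 1)] is
    [[- i_0, p - i_0)], and inductively the ancestor of level [n] is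
    [[- offset n, p ^ n - offset n)]. *)
Definition offset (n : nat) (x : Borel (phase R hp)) : nat :=
  (\sum_(k < n) hati (- k%:Z) x * p ^ k)%N.

(** One step zooms into the cell of number [hati 1] of [[0, 1)]. *)
Lemma offset_M_p n x : offset n.+1 (M_p x) = (p * offset n x + hati 1%R x)%N.
Proof.
rewrite /offset big_ord_recl /= expn0 muln1 addnC; congr addn.
  rewrite big_distrr; apply: eq_bigr => k _ /=.
  rewrite expnS mulnCA; congr (_ * (_ * _))%N.
  rewrite /hati /M_p /= /shift; congr (digit_val (x.2 _)).
  by rewrite /bump /= add1n intS opprD addrAC addNr add0r.
Qed.

Lemma past_offset n l : past [set x | offset n x = l].
Proof.
pose T := g_sigma_algebraType past_gen.
suff H : measurable ([set x | offset n x = l] : set T) by exact: H.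
elim: n l => [|n IH] l.
  have [->|l0] := eqVneq l 0%N.
    rewrite (_ : [set _ | _] = setT)//.
    by apply/seteqP; split => // x _; rewrite /offset /= big_ord0.
  rewrite (_ : [set _ | _] = set0)//.
  by apply/seteqP; split => // x /=; rewrite /offset big_ord0 => /esym/eqP; rewrite (negbTE l0).
rewrite (_ : [set _ | _] = \bigcup_(j : digit hp) \bigcup_m
  (([set x | offset n x = m] : set T) `&` ([set x | hati (- n%:Z) x = j] : set T) `&`
   [set x : T | (m + j * p ^ n)%N = l])).
  apply: bigcup_digit_measurable => j; apply: bigcupT_measurable => m.
  apply: measurableI.
    apply: measurableI; first exact: IH.
    by apply: sub_sigma_algebra; right; exists (- n%:Z), j; rewrite oppr_le0.
  have [->|nl] := pselect ((m + j * p ^ n)%N = l).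
    by rewrite (_ : [set _ | _] = setT)//; apply/seteqP; split.
  by rewrite (_ : [set _ | _] = set0)//; apply/seteqP; split.
apply/seteqP; split => [x /= <-|x [j _ [m _ [[/= <- <-]]]] /= <-].
  exists (hati (- n%:Z) x) => //; exists (offset n x) => //; split => //=.
  by rewrite /offset big_ord_recr.
by rewrite /offset big_ord_recr.
Qed.

End phase_space.

(** * Integrals of past-measurable functions *)

Section sub_sigma_algebra_integral.
Context d {T : measurableType d} {R : realType} (P : {measure set T -> \bar R}).
Variable G : set (set T).
Hypothesis GT : <<s G >> `<=` measurable.
Import HBNNSimple.
Local Open Scope ereal_scope.

Let integral_simple (k : T -> \bar R) (h : {nnsfun (g_sigma_algebraType G) >-> R}) :
  measurable_fun setT k -> (forall x, 0 <= k x) ->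
  \int[P]_x ((h x)%:E * k x) =
  \sum_(r \in range h) (r%:E * \int[P]_(x in h @^-1` [set r]) k x).
Proof.
move=> mk k0.
have mA r : measurable (h @^-1` [set r] : set T).
  by apply: GT; exact: (measurable_sfunP h).
have -> : \int[P]_x ((h x)%:E * k x) =
    \int[P]_x (\sum_(r \in range h) (r%:E * (\1_(h @^-1` [set r]) x)%:E * k x)).
  apply: eq_integral => x _.
  rewrite fimfunE -fsumEFin// ge0_mule_fsuml//.
  by move=> r; rewrite EFinM nnfun_muleindic_ge0.
rewrite ge0_integral_fsum//.
- apply: eq_fsbigr => r; rewrite inE => -[y _ <-].
  under eq_integral do rewrite -muleA.
  rewrite ge0_integralZl//.
  + congr (_ * _); rewrite [RHS]integral_mkcond; apply: eq_integral => x _.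
    by rewrite patchE indicE; case: ifP => _; rewrite ?mul1e ?mul0e.
  + apply: emeasurable_funM => //; apply/measurable_EFinP.
    exact: measurable_indic.
  + by move=> x _; rewrite mule_ge0// lee_fin indicE.
  + by rewrite lee_fin.
- move=> r; apply: emeasurable_funM => //; apply/measurable_EFinP.
  apply: measurable_funM => //; exact: measurable_indic.
- by move=> r x _; rewrite mule_ge0// nnfun_muleindic_ge0.
Qed.

(** By linearity the equality extends from events to simple functions, and then by
    monotone convergence. *)
Lemma ge0_integral_eq_sub (k1 k2 : T -> \bar R) (h : g_sigma_algebraType G -> \bar R) :
  measurable_fun setT k1 -> (forall x, 0 <= k1 x < +oo) ->
  measurable_fun setT k2 -> (forall x, 0 <= k2 x < +oo) ->
  (forall A, <<s G >> A -> \int[P]_(x in A) k1 x = \int[P]_(x in A) k2 x) ->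
  measurable_fun setT h -> (forall x, 0 <= h x) ->
  \int[P]_x (h x * k1 x) = \int[P]_x (h x * k2 x).
Proof.
move=> mk1 k10 mk2 k20 k12 mh h0.
pose h_ := nnsfun_approx measurableT mh.
have mh_ n : measurable_fun [set: T] (h_ n : T -> R).
  move=> _ A mA; apply: GT.
  exact: (measurable_funP (h_ n) measurableT A mA).
have cvgk (k : T -> \bar R) : measurable_fun setT k -> (forall x, 0 <= k x < +oo) ->
    \int[P]_x ((h_ n x)%:E * k x) @[n --> \oo] --> \int[P]_x (h x * k x).
  move=> mk k0oo.
  have k0 x : 0 <= k x by case/andP: (k0oo x).
  rewrite (_ : \int[P]_x (h x * k x) = \int[P]_x limn (fun n => (h_ n x)%:E * k x)).
    apply: cvg_monotone_convergence => //.
    - by move=> n; apply: emeasurable_funM => //; exact/measurable_EFinP.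
    - by move=> n x _; rewrite mule_ge0// lee_fin.
    - move=> x _ a b ab; rewrite lee_wpmul2r// lee_fin.
      by have /lefP/(_ x) := nd_nnsfun_approx measurableT mh ab.
  apply: eq_integral => x _; apply/esym/cvg_lim => //.
  apply: cvgeZr; first by rewrite ge0_fin_numE//; case/andP: (k0oo x).
  by apply: cvg_nnsfun_approx => // y _; exact: h0.
rewrite -(cvg_lim _ (cvgk k1 mk1 k10))// -(cvg_lim _ (cvgk k2 mk2 k20))//.
congr (limn _); apply/funext => n.
have k1_ge0 x : 0 <= k1 x by case/andP: (k10 x).
have k2_ge0 x : 0 <= k2 x by case/andP: (k20 x).
rewrite !integral_simple//; apply: eq_fsbigr => r _; congr (_ * _).
by apply: k12; exact: (measurable_sfunP (h_ n)).
Qed.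

End sub_sigma_algebra_integral.

(** * Masses of normalized measures *)

Section mass.
Context {R : realType}.
Implicit Type nu : radon R.

Definition mass nu (a b : R) : R := fine (nu `[a, b[%classic).

Lemma massE nu a b : nu `[a, b[%classic = (mass nu a b)%:E.
Proof. by rewrite /mass fineK// itv_co_fin. Qed.

Lemma mass_ge0 nu a b : 0 <= mass nu a b.
Proof. exact: fine_ge0. Qed.

Lemma massD nu a b c : a <= b -> b <= c -> mass nu a c = mass nu a b + mass nu b c.
Proof.
move=> ab bc; apply: EFin_inj; rewrite EFinD -!massE -measureU//.
  by rewrite -itv_bndbnd_setU// bnd_simp.
apply/seteqP; split => // x [/=]; rewrite !in_itv/= => /andP[_ xb] /andP[bx _].
by move: (lt_le_trans xb bx); rewrite ltxx.
Qed.

Lemma mass_le nu a b a' b' : a' <= a -> b <= b' -> mass nu a b <= mass nu a' b'.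
Proof.
move=> aa bb; rewrite -lee_fin -!massE; apply: le_measure; rewrite ?inE//.
by apply: subset_itv; rewrite bnd_simp.
Qed.

Lemma psi_eq1 nu : 0 < mass nu 0 1 -> psi nu = 1%N.
Proof.
move=> nu0; apply: min_nat_eq; last by move=> m [].
by split => //; rewrite /window subrr oppr0 massE lte_fin.
Qed.

Lemma nrmE nu (A : set R) : 0 < mass nu 0 1 -> measurable A ->
  (nrm nu A = (mass nu 0 1)^-1%:E * nu A)%E.
Proof.
move=> nu0 mA; rewrite /nrm /radon_of /= borel_partE// /mscale /=.
by rewrite psi_eq1// /window subrr oppr0.
Qed.

Lemma nrm_mass nu a b : 0 < mass nu 0 1 -> mass (nrm nu) a b = mass nu a b / mass nu 0 1.
Proof. by move=> nu0; rewrite /mass nrmE// massE -EFinM/= mulrC. Qed.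

Lemma mstar_eq (nu nu' : mstar R) : (forall A, measurable A -> nu A = nu' A) -> nu = nu'.
Proof. by move=> h; apply: val_inj; exact: radon_eq. Qed.

(** Either [[0, 1)] is charged and has been used to normalize, or it has mass 0. *)
Lemma mstar01 (nu : mstar R) : mass nu 0 1 = 0 \/ mass nu 0 1 = 1.
Proof.
have [nu' _ nuE] : normalized (val nu) := set_mem (valP nu).
have [m0|m0] := ltP 0 (mass nu' 0 1).
  right; rewrite (_ : nu = nrm nu'); last by apply: val_inj; rewrite -nuE.
  by rewrite nrm_mass// mulfV// gt_eqF.
have z : (nu' `[0%R, 1%R[%classic = 0)%E.
  by rewrite massE; congr EFin; apply/eqP; rewrite eq_le m0 mass_ge0.
by left; rewrite /mass /radon_of -nuE /= borel_partE// /mscale [X in (_ * X)%E]z mule0.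
Qed.

Lemma translate_mass x nu a b : mass (translate x nu) a b = mass nu (a + x) (b + x).
Proof.
rewrite /mass pushE//; congr (fine (nu _)); apply/seteqP.
by split => y /=; rewrite /tr !in_itv/= lerBrDr ltrBlDr.
Qed.

Lemma tstar_mass x (nu : mstar R) a b : 0 < mass nu x (1 + x) ->
  mass (tstar x nu) a b = mass nu (a + x) (b + x) / mass nu x (1 + x).
Proof. by move=> nu0; rewrite nrm_mass !translate_mass add0r. Qed.

Lemma tstarE x (nu : mstar R) A : 0 < mass nu x (1 + x) -> measurable A ->
  (tstar x nu A = (mass nu x (1 + x))^-1%:E * nu (tr x @^-1` A))%E.
Proof.
by move=> nu0 mA; rewrite nrmE// translate_mass add0r// pushE.
Qed.

(** When both translated unit intervals are charged, the intermediate normalization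
    cancels out. *)
Lemma tstarD x y (nu : mstar R) : 0 < mass nu x (1 + x) ->
  0 < mass nu (x + y) (1 + (x + y)) -> tstar y (tstar x nu) = tstar (x + y) nu.
Proof.
move=> nux nuxy.
have e1 : y + x = x + y by rewrite addrC.
have e2 : 1 + y + x = 1 + (x + y) by rewrite -addrA e1.
have nuy : 0 < mass (tstar x nu) y (1 + y).
  by rewrite tstar_mass// e1 e2 divr_gt0.
have mtr z : measurable_fun setT (@tr R z).
  exact: continuous_measurable_fun (@tr_continuous R z).
have mpre z (A : set R) : measurable A -> measurable (tr z @^-1` A).
  by move=> mA; rewrite -[X in measurable X]setTI; exact: mtr.
apply: mstar_eq => A mA; rewrite !tstarE//; last exact: mpre.
rewrite tstar_mass// e1 e2 muleA -EFinM invfM invrK.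
rewrite -mulrA mulfV ?gt_eqF// mulr1; congr (_ * nu _)%E.
by apply/seteqP; split => z; rewrite /= /tr -addrA -opprD.
Qed.

End mass.

(** * Zooming into the cells of the unit interval *)

Section zoom.
Context {R : realType} (p : nat) (hp : (2 <= p)%N).

Definition digit_mod (l : nat) : digit hp := Ordinal (ltn_pmod l (ltnW hp)).

(** The successive normalizations are those of the dynamics: each step selects the
    cell given by the next digit of [l] in base [p], the last digit being the finest. *)
Fixpoint zoom (n l : nat) (nu : mstar R) : mstar R :=
  if n is n'.+1 then nrm (push_rho (digit_mod l) (zoom n' (l %/ p) nu)) else nu.

Definition cell_mass (n l : nat) (nu : mstar R) : R :=
  mass nu (l%:R / (p ^ n)%:R) (l.+1%:R / (p ^ n)%:R).

Let pn_gt0 n : 0 < (p ^ n)%:R :> R.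
Proof. by rewrite ltr0n expn_gt0 (ltnW hp). Qed.

Lemma cell_mass_ge0 n l nu : 0 <= cell_mass n l nu. Proof. exact: mass_ge0. Qed.

(** The cell [l] of level [n + 1] lies in the cell [l %/ p] of level [n]. *)
Lemma cell_massS n l nu : cell_mass n.+1 l nu <= cell_mass n (l %/ p) nu.
Proof.
apply: mass_le.
  rewrite ler_pdivlMr// mulrAC ler_pdivrMr// -!natrM ler_nat expnS mulnA.
  by rewrite leq_mul2r leq_trunc_div orbT.
rewrite ler_pdivlMr// mulrAC ler_pdivrMr// -!natrM ler_nat expnS mulnA.
by rewrite leq_mul2r ltn_ceil ?orbT// ltnW.
Qed.

Lemma cell_mass_le n l nu : (l < p ^ n)%N -> cell_mass n l nu <= mass nu 0 1.
Proof.
by move=> ln; apply: mass_le; rewrite ?divr_ge0// ler_pdivrMr// mul1r ler_nat.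
Qed.

Lemma cell_mass_sum n l l' nu : (l <= l')%N ->
  \sum_(l <= k < l') cell_mass n k nu = mass nu (l%:R / (p ^ n)%:R) (l'%:R / (p ^ n)%:R).
Proof.
elim: l' => [|l' IH].
  by rewrite leqn0 => /eqP ->; rewrite big_geq// /mass set_itvco0 measure0.
rewrite leq_eqVlt => /predU1P[->|]; first by rewrite big_geq// /mass set_itvco0 measure0.
rewrite ltnS => ll'; rewrite big_nat_recr//= IH// -massD//.
  by rewrite ler_pM2r ?invr_gt0// ler_nat.
by rewrite ler_pM2r ?invr_gt0// ler_nat.
Qed.

(** The normalizations telescope: the total effect is the affine map that sends the
    cell [l] onto [[0, 1)], followed by the division by the mass of the cell. *)
Lemma zoomE n l (nu : mstar R) (A : set R) : mass nu 0 1 = 1 -> (l < p ^ n)%N ->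
    0 < cell_mass n l nu ->
  measurable A -> (zoom n l nu A =
    (cell_mass n l nu)^-1%:E * nu ((fun y : R => ((p ^ n)%:R * y - l%:R)%R) @^-1` A))%E.
Proof.
move=> nu1; elim: n l A => [|n IH] l A ln cl mA.
  move: ln; rewrite expn0 ltnS leqn0 => /eqP ->.
  rewrite /cell_mass !divr1 nu1 invr1 mul1e; congr (nu _).
  by apply/seteqP; split => y /=; rewrite mul1r subr0.
have cl' : 0 < cell_mass n (l %/ p) nu by exact: lt_le_trans cl (cell_massS _ _ _).
have ln' : (l %/ p < p ^ n)%N by rewrite ltn_divLR ?(ltnW hp)// mulnC -expnS.
have mrho (B : set R) : measurable B -> measurable (rho (R := R) (digit_mod l) @^-1` B).
  move=> mB; rewrite -[X in measurable X]setTI.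
  exact: (continuous_measurable_fun (@rho_continuous R p hp (digit_mod l))).
have pre (B : set R) : ((fun y : R => (p ^ n)%:R * y - (l %/ p)%:R) @^-1`
    (rho (R := R) (digit_mod l) @^-1` B)) = (fun y : R => (p ^ n.+1)%:R * y - l%:R) @^-1` B.
  apply/seteqP; split => y; rewrite /= /rho mulrBr mulrA -natrM -expnS -addrA -opprD;
  by rewrite -natrM -natrD mulnC /digit_val /= -divn_eq.
have m1 : mass (push_rho (digit_mod l) (zoom n (l %/ p) nu)) 0 1 =
    cell_mass n.+1 l nu / cell_mass n (l %/ p) nu.
  rewrite /mass pushE// IH//; last exact: mrho.
  rewrite pre (_ : _ @^-1` _ = `[l%:R / (p ^ n.+1)%:R, l.+1%:R / (p ^ n.+1)%:R[%classic).
    by rewrite massE -EFinM /= mulrC.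
  apply/seteqP; split => y /=; rewrite !in_itv/= subr_ge0 ltrBlDr nat1r;
  by rewrite ler_pdivrMr// ltr_pdivlMr// mulrC.
rewrite /= nrmE//; last by rewrite m1 divr_gt0.
rewrite pushE// IH//; last exact: mrho.
rewrite pre m1 muleA -EFinM invfM invrK -mulrA mulfV ?gt_eqF// mulr1 //.
Qed.

Lemma zoom_mass n l (nu : mstar R) k k' : mass nu 0 1 = 1 -> (l < p ^ n)%N ->
    0 < cell_mass n l nu ->
  mass (zoom n l nu) k k' =
  mass nu ((k + l%:R) / (p ^ n)%:R) ((k' + l%:R) / (p ^ n)%:R) / cell_mass n l nu.
Proof.
move=> nu1 ln cl; rewrite /mass zoomE//.
rewrite (_ : _ @^-1` _ = `[(k + l%:R) / (p ^ n)%:R, (k' + l%:R) / (p ^ n)%:R[%classic).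
  by rewrite massE -EFinM /= mulrC.
apply/seteqP; split => y /=; rewrite !in_itv/= lerBrDr ltrBlDr;
by rewrite ler_pdivrMr// ltr_pdivlMr// mulrC.
Qed.

(** Both sides are the normalized image of [nu] under affine maps of the same slope. *)
Lemma tstar_zoom n l k (nu : mstar R) : mass nu 0 1 = 1 -> (l + k < p ^ n)%N ->
  0 < cell_mass n l nu -> 0 < cell_mass n (l + k) nu ->
  tstar k%:R (zoom n l nu) = zoom n (l + k) nu.
Proof.
move=> nu1 lkn cl clk; have ln := leq_ltn_trans (leq_addr _ _) lkn.
have mk : mass (zoom n l nu) k%:R (1 + k%:R) = cell_mass n (l + k) nu / cell_mass n l nu.
  by rewrite zoom_mass// -addrA -!natrD [(k + l)%N]addnC nat1r.
apply: mstar_eq => A mA.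
rewrite tstarE// ?mk ?divr_gt0// !zoomE//; last first.
  rewrite -[X in measurable X]setTI.
  exact: (continuous_measurable_fun (@tr_continuous R k%:R)).
rewrite muleA -EFinM invfM invrK -mulrA mulfV ?gt_eqF// mulr1.
congr (_ * nu _)%E; apply/seteqP; split => y; rewrite /= /tr -addrA -opprD natrD //.
Qed.

End zoom.

(** * The block formula *)

Lemma ae_forall_count d (T : measurableType d) (R : realType) (mu : {measure set T -> \bar R})
    (I : countType) (P : I -> T -> Prop) :
  (forall i, {ae mu, forall x, P i x}) -> {ae mu, forall x, forall i, P i x}.
Proof.
move=> mP.
have H : {ae mu, forall x, forall n i, unpickle n = Some i -> P i x}.
  apply: ae_foralln => n; case: (unpickle n) => [i|]; last exact: aeW.
  by apply: filterS (mP i) => x Px j [<-].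
by apply: filterS H => x h i; apply: (h (pickle i)); rewrite pickleK.
Qed.

Section block_formula.
Context {R : realType} (p : nat) (hp : (2 <= p)%N) (Q : probability (Borel (phase R hp)) R).
Hypotheses (adQ : adapted Q) (invQ : Defs.invariant Q).
Local Open Scope ereal_scope.

Lemma ge0_integral_M_p (F : Borel (phase R hp) -> \bar R) :
  measurable_fun setT F -> (forall x, 0 <= F x) ->
  \int[Q]_x F (M_p x) = \int[Q]_x F x.
Proof.
move=> mF F0.
have := @ge0_integral_pushforward _ _ _ _ R M_p (@measurable_M_p R p hp) Q setT F measurableT mF
  (fun x _ => F0 x).
rewrite preimage_setT => <-; apply: eq_measure_integral => A mA _.
exact: invQ.
Qed.

Lemma measurable_digit_mass (j : digit hp) :
  measurable_fun setT (fun x : Borel (phase R hp) => (hatnu x : mstar R) (cell j)).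
Proof.
exact: (measurableT_comp (@measurable_mass R ((j : nat)%:R / p%:R)%R ((j : nat).+1%:R / p%:R)%R)
  (@measurable_hatnu R p hp)).
Qed.

(** Adaptedness speaks of a chosen version of the conditional probability, which is
    a genuine one because such versions exist. *)
Lemma adapted_set (j : digit hp) (A : set (Borel (phase R hp))) : past A ->
  \int[Q]_(x in A) (hatnu x : mstar R) (cell j) = Q (A `&` [set x | hati 1 x = j]).
Proof.
move=> pA; have mA := past_measurable pA.
have mj := measurable_hati (R := R) (hp := hp) 1 j.
set E := [set x | hati 1 x = j] in mj *.
have iE : Q.-integrable setT (EFin \o \1_E).
  apply/integrableP; split; first by apply/measurable_EFinP; exact: measurable_indic.
  rewrite (eq_integral (EFin \o \1_E)); last by move=> x _ /=; rewrite ger0_norm// indicE.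
  by rewrite integral_indic// setIT (le_lt_trans (probability_le1 Q mj))// ltry.
have [_ ig /(_ _ pA)] := condexpP (past_sigma (R := R) hp) (@past_measurable R p hp) iE.
rewrite integral_indic// setIC => <-.
apply: ae_eq_integral => //; first exact: measurable_funTS (measurable_digit_mass j).
  by apply: measurable_funTS; exact: measurable_int ig.
by apply: filterS (adQ j) => x h _; rewrite -h.
Qed.

Lemma measurable_offset_fun n (F : nat -> Borel (mstar R) -> \bar R) :
  (forall l, measurable_fun setT (F l)) ->
  measurable_fun setT ((fun x => F (offset n x) (hatnu x)) :
    g_sigma_algebraType (@past_gen R p hp) -> \bar R).
Proof.
move=> mF; apply: (@measurable_nat_index _ _ (g_sigma_algebraType (@past_gen R p hp)) _
  (offset n) (fun l x => F l (hatnu x))) => l; first exact: past_offset.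
apply: (measurableT_comp (mF l)) => _ B mB; rewrite setTI.
by apply: sub_sigma_algebra; left; exists B.
Qed.

Lemma measurable_offset_funT n (F : nat -> Borel (mstar R) -> \bar R) :
  (forall l, measurable_fun setT (F l)) ->
  measurable_fun setT (fun x : Borel (phase R hp) => F (offset n x) (hatnu x)).
Proof.
move=> /(measurable_offset_fun n) mF _ A mA; apply: past_measurable.
exact: mF.
Qed.

(** The offset and the present measure are known from the past. *)
Lemma adapted_integral n (j : digit hp) (F : nat -> Borel (mstar R) -> \bar R) :
  (forall l, measurable_fun setT (F l)) -> (forall l nu, 0 <= F l nu) ->
  \int[Q]_x (F (offset n x) (hatnu x) * (hatnu x : mstar R) (cell j)) =
  \int[Q]_x (F (offset n x) (hatnu x) * (\1_[set x | hati 1 x = j] x)%:E).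
Proof.
move=> mF F0; have mj := measurable_hati (R := R) (hp := hp) 1 j.
apply: (@ge0_integral_eq_sub _ _ _ _ (@past_gen R p hp) (@past_measurable R p hp) _ _
  (fun x => F (offset n x) (hatnu x))) => //.
- exact: measurable_digit_mass.
- by move=> x; rewrite massE lee_fin mass_ge0 ltry.
- by apply/measurable_EFinP; exact: measurable_indic.
- by move=> x; rewrite lee_fin indicE ltry ler0n.
- move=> A pA; rewrite adapted_set// integral_indic//; first by rewrite setIC.
  exact: past_measurable.
- exact: measurable_offset_fun.
Qed.

Lemma cellE (j : digit hp) (nu : mstar R) : nu (cell j) = (cell_mass p 1 j nu)%:E.
Proof. by rewrite massE /cell_mass expn1. Qed.

(** The digit that is drawn has positive probability, by adaptedness on the event
    that the mass of the cell [j] vanishes. *)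
Lemma cell_charged : {ae Q, forall x, (0 < cell_mass p 1 (hati 1%R x) (hatnu x))%R}.
Proof.
pose E (j : digit hp) : set (Borel (phase R hp)) :=
  [set x | (hatnu x : mstar R) (cell j) = 0].
have pE j : past (E j).
  apply: sub_sigma_algebra; left.
  exists ((fun nu : mstar R => nu (cell j)) @^-1` [set 0]) => //.
  by rewrite -[X in measurable X]setTI; exact: measurable_mass.
have QE j : Q (E j `&` [set x | hati 1 x = j]) = 0.
  by rewrite -adapted_set//; apply: integral0_eq => x.
have H (j : 'I_p) : {ae Q, forall x, hati 1%R x = j -> (0 < cell_mass p 1 j (hatnu x))%R}.
  have mE : measurable (E j `&` [set x | hati 1 x = j]).
    by apply: measurableI; [exact: past_measurable|exact: measurable_hati].
  apply: negligibleS ((negligibleP Q mE).2 (QE j)) => x /= /not_implyP[xj]; move/negP;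
    rewrite -leNgt => cj; split => //=.
  by rewrite /E /= cellE; congr EFin; apply/eqP; rewrite eq_le cj mass_ge0.
have := ae_forall_count H.
by apply: filterS => x /(_ (hati 1%R x)); exact.
Qed.

(** If [[0, 1)] had mass 0, then so would all of its cells, and no digit could be
    drawn. *)
Lemma unit_mass : {ae Q, forall x, mass (hatnu x : mstar R) 0 1 = 1%R}.
Proof.
pose E : set (Borel (phase R hp)) := [set x | mass (hatnu x : mstar R) 0 1 = 0%R].
have pE : past E.
  apply: sub_sigma_algebra; left.
  exists ((fun nu : mstar R => nu `[0%R, 1%R[%classic) @^-1` [set 0]).
    by rewrite -[X in measurable X]setTI; exact: measurable_mass.
  by apply/seteqP; split => x; rewrite /E /= massE => h; [rewrite h|case: h].
have mE : measurable E by exact: past_measurable.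
have QE (j : 'I_p) : Q (E `&` [set x | hati 1 x = (j : digit hp)]) = 0.
  rewrite -adapted_set//; apply: integral0_eq => x xE.
  rewrite cellE; apply/eqP; rewrite eqe eq_le cell_mass_ge0 andbT.
  have x0 : mass (hatnu x : mstar R) 0 1 = 0%R := xE.
  by rewrite -x0; apply: (cell_mass_le hp); rewrite expn1 ltn_ord.
have H (j : 'I_p) : {ae Q, forall x, hati 1%R x = j -> ~ E x}.
  have mEj : measurable (E `&` [set x | hati 1 x = (j : digit hp)]).
    by apply: measurableI => //; exact: measurable_hati.
  apply: negligibleS ((negligibleP Q mEj).2 (QE j)) => x /=.
  by move=> /not_implyP[xj]; move/contrapT => Ex; split.
have := ae_forall_count H.
apply: filterS => x /(_ (hati 1%R x) erefl) nE.
by have [/nE|] := mstar01 (hatnu x).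
Qed.

Lemma measurable_zoom n l :
  measurable_fun setT (zoom hp n l : Borel (mstar R) -> Borel (mstar R)).
Proof.
elim: n l => [|n IH] l; first exact: measurable_id.
exact: (measurableT_comp (measurable_zoom_digit (digit_mod hp l)) (IH (l %/ p)%N)).
Qed.

Lemma measurable_cell_mass n l : measurable_fun setT (cell_mass p n l : Borel (mstar R) -> R).
Proof.
by apply: measurableT_comp => //; exact: measurable_mass.
Qed.

Lemma measurable_block n (F : nat -> Borel (mstar R) -> \bar R) :
  (forall l, measurable_fun setT (F l)) -> measurable_fun setT (fun nu : Borel (mstar R) =>
    \sum_(l < p ^ n) (cell_mass p n l nu)%:E * F l (zoom hp n l nu)).
Proof.
move=> mF; apply: emeasurable_sum => l _; apply: emeasurable_funM => //.
  by apply/measurable_EFinP; exact: measurable_cell_mass.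
exact: (measurableT_comp (mF l) (measurable_zoom n l)).
Qed.

(** Multiplicativity of the conditional masses along nested cells. *)
Lemma cell_mass_zoom n l (j : digit hp) (nu : mstar R) : mass nu 0 1 = 1%R -> (l < p ^ n)%N ->
  (cell_mass p n l nu * cell_mass p 1 j (zoom hp n l nu) = cell_mass p n.+1 (p * l + j) nu)%R.
Proof.
move=> nu1 ln.
have lj : ((p * l + j) %/ p)%N = l.
  by rewrite mulnC divnMDl ?(ltnW hp)// divn_small ?addn0//; exact: ltn_ord.
have [cl|cl] := ltP 0%R (cell_mass p n l nu); last first.
  have c0 : cell_mass p n l nu = 0%R by apply/eqP; rewrite eq_le cl cell_mass_ge0.
  rewrite c0 mul0r; apply/esym/eqP; rewrite eq_le cell_mass_ge0 andbT -c0 -{2}lj.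
  exact: cell_massS.
rewrite {2}/cell_mass zoom_mass// mulrCA mulfV ?gt_eqF// mulr1 /cell_mass.
have p0 : p%:R != 0%R :> R by rewrite pnatr_eq0 -lt0n ltnW.
have pn0 : (p ^ n)%:R != 0%R :> R by rewrite pnatr_eq0 -lt0n expn_gt0 (ltnW hp).
have E (k : nat) : ((k%:R / (p ^ 1)%:R + l%:R) / (p ^ n)%:R = (p * l + k)%:R / (p ^ n.+1)%:R :>
    R)%R.
  by rewrite expn1 expnS natrD !natrM; field; rewrite pn0.
by rewrite !E addnS.
Qed.

Lemma zoomS n l (j : digit hp) (nu : mstar R) :
  zoom hp n.+1 (p * l + j) nu = nrm (push_rho j (zoom hp n l nu)).
Proof.
have jp : (j < p)%N := ltn_ord j.
have dj : digit_mod hp (p * l + j) = j.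
  by apply: val_inj; rewrite /= mulnC modnMDl modn_small.
have lj : ((p * l + j) %/ p)%N = l by rewrite mulnC divnMDl ?(ltnW hp)// divn_small// addn0.
by rewrite [LHS]/= dj lj.
Qed.

(** By induction on [n].  Invariance replaces the present by the next step, adaptedness
    averages over the new digit, and the induction hypothesis expresses the result
    by the cells of level [n], each of which splits into its [p] children. *)
Lemma block_formula n (F : nat -> Borel (mstar R) -> \bar R) :
  (forall l, measurable_fun setT (F l)) -> (forall l nu, 0 <= F l nu) ->
  \int[Q]_x F (offset n x) (hatnu x) =
  \int[Q]_x \sum_(l < p ^ n) (cell_mass p n l (hatnu x))%:E * F l (zoom hp n l (hatnu x)).
Proof.
elim: n F => [|n IH] F mF F0.
  apply: ae_eq_integral => //.
  - exact: measurable_offset_funT.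
  - exact: (measurableT_comp (measurable_block 0 mF) (@measurable_hatnu R p hp)).
  - apply: filterS unit_mass => x x1 _.
    rewrite expn0 big_ord1 /offset big_ord0 /cell_mass /= expn0 !divr1.
    by rewrite x1 mul1e.
(* The average of [F] over the next digit, the offset being [l] before it is drawn. *)
pose F' l (nu : Borel (mstar R)) :=
  \sum_(j < p) F (p * l + j)%N (nrm (push_rho (j : digit hp) (nu : mstar R))) * (nu : mstar R)
    (cell (j : digit hp)).
have mFz l (j : digit hp) :
    measurable_fun setT (fun nu : Borel (mstar R) =>
      F (p * l + j)%N (nrm (push_rho j (nu : mstar R)))).
  exact: (measurableT_comp (mF (p * l + j)%N) (measurable_zoom_digit j)).
have mF' l : measurable_fun setT (F' l).
  apply: emeasurable_sum => j _; apply: emeasurable_funM => //; first exact: mFz.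
  exact: measurable_mass.
have F'0 l nu : 0 <= F' l nu by apply: sume_ge0 => j _; exact: mule_ge0.
transitivity (\int[Q]_x F' (offset n x) (hatnu x)); last first.
  rewrite IH//; apply: ae_eq_integral => //.
  - exact: (measurableT_comp (measurable_block n mF') (@measurable_hatnu R p hp)).
  - exact: (measurableT_comp (measurable_block n.+1 mF) (@measurable_hatnu R p hp)).
  - apply: filterS unit_mass => x x1 _; set nu : mstar R := hatnu x in x1 *.
    rewrite [RHS](_ : _ = \sum_(0 <= l < p ^ n * p) (cell_mass p n.+1 l nu)%:E * F l
      (zoom hp n.+1 l nu));
      last by rewrite -expnSr big_mkord.
    rewrite big_nat_mul big_mkord; apply: eq_bigr => l _.
    rewrite -[X in index_iota X _]add0n big_addn mulSn addnK big_mkord ge0_sume_distrr.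
      apply: eq_bigr => j _.
      have -> : (j + l * p = p * l + j)%N by rewrite addnC mulnC.
      rewrite cellE -zoomS muleCA muleC -EFinM cell_mass_zoom//.
    by move=> j _; exact: mule_ge0.
rewrite -ge0_integral_M_p//; last exact: (measurable_offset_funT n.+1).
rewrite ge0_integral_sum//; last 2 first.
- move=> j; apply: emeasurable_funM => //; last exact: measurable_digit_mass.
  exact: (measurable_offset_funT n (fun l => mFz l j)).
- by move=> j x _; exact: mule_ge0.
transitivity (\int[Q]_x \sum_(j < p) (F (p * offset n x + j)%N
    (nrm (push_rho (j : digit hp) (hatnu x : mstar R))) *
    (\1_[set x | hati 1 x = (j : digit hp)] x)%:E)).
  apply: eq_integral => x _; rewrite offset_M_p.
  rewrite (bigD1 (hati 1%R x))//= big1 ?adde0.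
    by rewrite indicE mem_set// mule1.
  move=> j /eqP ji; rewrite indicE memNset ?mule0// => /= ij.
  exact/ji/esym.
rewrite ge0_integral_sum//; last 2 first.
- move=> j; apply: emeasurable_funM => //.
    exact: (measurable_offset_funT n (fun l => mFz l j)).
  by apply/measurable_EFinP; apply: measurable_indic; exact: measurable_hati.
- by move=> j x _; rewrite mule_ge0// lee_fin indicE ler0n.
by apply: eq_bigr => j _; rewrite (adapted_integral n _ (fun l => mFz l j)).
Qed.

End block_formula.

(** * Decay of the conditional probabilities *)

Section recurrence.
Context {R : realType} (p : nat) (hp : (2 <= p)%N) (Q : probability (Borel (phase R hp)) R).
Hypotheses (adQ : adapted Q) (invQ : Defs.invariant Q) (ergQ : ergodic Q).
Hypothesis ndQ : ~ deterministic Q.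

Local Notation M := (@M_p R p hp).

Lemma measurable_iter_M n : measurable_fun setT (iter n M).
Proof.
elim: n => [|n IH]; first exact: measurable_id.
exact: (measurableT_comp (@measurable_M_p R p hp) IH).
Qed.

Lemma measurable_iter_preimage n A : measurable A -> measurable (iter n M @^-1` A).
Proof. by move=> mA; rewrite -[X in measurable X]setTI; exact: measurable_iter_M. Qed.

Lemma invariant_iter n A : measurable A -> Q (iter n M @^-1` A) = Q A.
Proof.
elim: n A => [//|n IH] A mA.
rewrite -(invQ mA) -(IH (M @^-1` A))//.
exact: (measurable_iter_preimage 1).
Qed.

Definition limsup_set (B : set (Borel (phase R hp))) : set (Borel (phase R hp)) :=
  \bigcap_N \bigcup_(n in [set n | (N <= n)%N]) iter n M @^-1` B.

(** The event that [B] is visited infinitely often is strictly invariant, and its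
    probability is at least that of [B]. *)
Lemma ergodic_recurrence B : measurable B -> (0 < Q B)%E -> Q (limsup_set B) = 1%E.
Proof.
move=> mB QB.
pose U N := \bigcup_(n in [set n | (N <= n)%N]) iter n M @^-1` B.
have mU N : measurable (U N).
  by apply: bigcup_measurable => n _; exact: measurable_iter_preimage.
have mL : measurable (limsup_set B) by exact: bigcapT_measurable.
have invL : M @^-1` limsup_set B = limsup_set B.
  apply/seteqP; split => x Lx N _.
    by have [n /= Nn Bn] := Lx N I; exists n.+1; [exact: leqW|rewrite /= -iterS iterSr].
  have [[|n] //= Nn Bn] := Lx N.+1 I.
  by exists n => //=; rewrite -iterSr.
have [Q0|//] := ergQ mL invL.
have : (Q \o U) n @[n --> \oo] --> Q (limsup_set B).
  apply: nonincreasing_cvg_mu => //.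
  - by rewrite (le_lt_trans (probability_le1 Q (mU 0%N)))// ltry.
  - by apply/nonincreasing_seqP => n; apply/subsetPset => x [m /= nm Bm]; exists m => //=;
      exact: ltnW.
move=> cU; have : (Q B <= Q (limsup_set B))%E.
  apply: (cvge_to_ge cU); apply: nearW => n /=; rewrite -(invariant_iter n mB).
  apply: le_measure; rewrite ?inE//; first exact: measurable_iter_preimage.
  by move=> x Bx; exists n => /=.
by rewrite Q0 leNgt QB.
Qed.

(** The conditional probability, given the past, of the digit that is drawn. *)
Definition weight (x : Borel (phase R hp)) : R := cell_mass p 1 (hati 1 x) (hatnu x).

Lemma weight_ge0 x : 0 <= weight x. Proof. exact: mass_ge0. Qed.

Lemma weight_le1 x : weight x <= 1.
Proof.
have : weight x <= mass (hatnu x : mstar R) 0 1.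
  by apply: (cell_mass_le hp); rewrite expn1; exact: ltn_ord.
by have [->|->] := mstar01 (hatnu x : mstar R) => // /le_trans; apply.
Qed.

Lemma measurable_weight : measurable_fun setT weight.
Proof.
pose idx (x : Borel (phase R hp)) : nat := hati 1 x.
apply: (@measurable_nat_index _ _ _ _ idx (fun j x => cell_mass p 1 j (hatnu x))) => j.
  have [jp|jp] := ltnP j p.
    rewrite (_ : [set _ | _] = [set x | hati 1 x = (Ordinal jp : digit hp)]).
      exact: measurable_hati.
    by apply/seteqP; split => x /= h; [exact: val_inj|rewrite /idx h].
  rewrite (_ : [set _ | _] = set0)//; apply/seteqP; split => // x /= xj.
  by move: jp; rewrite -xj leqNgt; rewrite (ltn_ord (hati 1 x)).
exact: (measurableT_comp (measurable_cell_mass p 1 j) (@measurable_hatnu R p hp)).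
Qed.

Lemma measurable_weight_lt c : measurable [set x | weight x < c].
Proof.
rewrite (_ : [set _ | _] = weight @^-1` `]-oo, c[%classic).
  by rewrite -[X in measurable X]setTI; exact: measurable_weight.
by apply/seteqP; split => x; rewrite /= in_itv.
Qed.

(** Otherwise the digit that is drawn would almost surely have conditional
    probability 1, which is determinism. *)
Lemma nondeterministic_weight : exists e : R, [/\ 0 < e, e < 1 &
  (0 < Q [set x | (weight x < 1 - e)%R])%E].
Proof.
apply: contrapT => none; apply: ndQ.
have H n : {ae Q, forall x, 1 - n.+2%:R^-1 <= weight x}.
  apply: (negligibleS _ ((negligibleP Q (measurable_weight_lt (1 - n.+2%:R^-1))).2 _)).
    by move=> x /=; move/negP; rewrite -ltNge.
  apply/eqP; rewrite eq_le measure_ge0 andbT leNgt; apply/negP => Q0.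
  by apply: none; exists n.+2%:R^-1; split => //; rewrite ?invr_gt0// invf_lt1// ltr1n.
have adA : {ae Q, forall x, forall j : 'I_p,
    (condprob Q (@past R p hp) [set y | hati 1 y = (j : digit hp)] x)%:E =
    (hatnu x : mstar R) (cell (j : digit hp))} by apply: ae_forall_count.
apply: filterS2 (ae_foralln H) adA => x wx /(_ (hati 1 x)).
rewrite cellE => -[->]; apply/eqP; rewrite eq_le [X in X && _]weight_le1/= leNgt.
apply/negP => /ltr_add_invr[k]; apply/negP; rewrite -leNgt -lerBlDr.
apply: le_trans (wx k); rewrite lerB// lef_pV2 ?posrE// ler_nat //.
Qed.

Definition weight_prod n x : R := \prod_(k < n) weight (iter k M x).

Lemma weight_prod_ge0 n x : 0 <= weight_prod n x.
Proof. by apply: prodr_ge0 => k _; exact: weight_ge0. Qed.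

Lemma weight_prod_le m n x : (m <= n)%N -> weight_prod n x <= weight_prod m x.
Proof.
elim: n => [|n IH]; first by rewrite leqn0 => /eqP ->.
rewrite leq_eqVlt => /predU1P[->//|]; rewrite ltnS => /IH; apply: le_trans.
rewrite /weight_prod big_ord_recr/= ler_piMr//; last exact: weight_le1.
exact: weight_prod_ge0.
Qed.

Lemma measurable_weight_prod n : measurable_fun setT (weight_prod n).
Proof.
apply: measurable_prod => k _.
exact: (measurableT_comp measurable_weight (measurable_iter_M k)).
Qed.

(** By recurrence, infinitely many of the factors are below [1 - e]. *)
Lemma weight_prod_small : {ae Q, forall x, forall d : R, 0 < d -> exists n,
    weight_prod n x < d}.
Proof.
have [e [e0 e1 QB]] := nondeterministic_weight.
pose B := [set x | weight x < 1 - e]; have mB : measurable B := measurable_weight_lt (1 - e).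
have mL : measurable (limsup_set B).
  by apply: bigcapT_measurable => N; apply: bigcup_measurable => n _;
    exact: measurable_iter_preimage.
have LQ : {ae Q, forall x, limsup_set B x}.
  apply/negligibleP; first exact: measurableC.
  have := probability_setC Q mL.
  by rewrite (ergodic_recurrence mB QB) subee// => <-.
apply: filterS LQ => x Lx d d0.
have small k : exists n, weight_prod n x <= (1 - e) ^+ k.
  elim: k => [|k [n IH]]; first by exists 0%N; rewrite /weight_prod big_ord0 expr0.
  have [m /= nm Bm] := Lx n I.
  exists m.+1; rewrite /weight_prod big_ord_recr exprSr/=.
  apply: ler_pM; [exact: weight_prod_ge0|exact: weight_ge0| |exact: ltW].
  exact: le_trans (weight_prod_le _ nm) IH.
have : (1 - e) ^+ k @[k --> \oo] --> (0 : R).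
  by apply: cvg_expr; rewrite ger0_norm; lra.
move=> /cvgrPdist_lt /(_ _ d0) [k _ /(_ k (leqnn k))] /=.
rewrite sub0r normrN ger0_norm; last by apply: exprn_ge0; lra.
by move=> kd; have [n nk] := small k; exists n; exact: le_lt_trans kd.
Qed.

Lemma weight_prod_prob (d : R) : 0 < d ->
  Q [set x | d <= weight_prod n x] @[n --> \oo] --> 0%E.
Proof.
move=> d0.
have mS n : measurable [set x | d <= weight_prod n x].
  rewrite (_ : [set _ | _] = weight_prod n @^-1` `[d, +oo[%classic).
    by rewrite -[X in measurable X]setTI; exact: measurable_weight_prod.
  by apply/seteqP; split => x; rewrite /= in_itv/= andbT.
rewrite (_ : 0%E = Q (\bigcap_n [set x | d <= weight_prod n x])).
  apply: nonincreasing_cvg_mu => //.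
  - by rewrite (le_lt_trans (probability_le1 Q (mS 0%N)))// ltry.
  - exact: bigcapT_measurable.
  - by move=> m n mn; apply/subsetPset => x /= /le_trans; apply; exact: weight_prod_le.
apply/esym/(negligibleP Q); first exact: bigcapT_measurable.
apply: negligibleS weight_prod_small => x /= Sx /(_ _ d0)[n].
by rewrite ltNge (Sx n I).
Qed.

End recurrence.

(** * Growth of the ancestors *)

Section finite_tails.
Variable R : realDomainType.

(** If a cell is picked with probability its mass, the total mass of the cells from it
    on is at least [s] up to an event of probability [s]: the cells with a tail of
    mass at most [s] form a final segment, of total mass at most [s]. *)
Lemma tail_sum_le (c : nat -> R) (s : R) (L : nat) : (forall l, 0 <= c l) -> 0 <= s ->
  \sum_(0 <= l < L) (if \sum_(l <= k < L) c k <= s then c l else 0) <= s.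
Proof.
move=> c0 s0.
suff H m : (m <= L)%N ->
    \sum_(L - m <= l < L) (if \sum_(l <= k < L) c k <= s then c l else 0) <= s.
  by have := H L (leqnn L); rewrite subnn.
elim: m => [|m IH] mL; first by rewrite subn0 big_geq.
have [Ts|nTs] := boolP (\sum_(L - m.+1 <= k < L) c k <= s).
  by apply: le_trans Ts; apply: ler_sum => l _; case: ifP.
have mL' : (L - m.+1 < L)%N by rewrite ltn_subrL (leq_trans _ mL).
rewrite (big_ltn mL') subnSK//.
by case: ifP => [/(negP nTs)//|_]; rewrite add0r; exact/IH/ltnW.
Qed.

End finite_tails.

Section escape.
Context {R : realType} (p : nat) (hp : (2 <= p)%N) (Q : probability (Borel (phase R hp)) R).
Hypotheses (adQ : adapted Q) (invQ : Defs.invariant Q) (ergQ : ergodic Q).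
Hypothesis ndQ : ~ deterministic Q.

Local Notation M := (@M_p R p hp).
Implicit Type x : Borel (phase R hp).

Lemma offset_lt n x : (offset n x < p ^ n)%N.
Proof.
elim: n => [|n IH]; first by rewrite /offset big_ord0.
rewrite /offset big_ord_recr /= expnS.
have := ltn_ord (hati (- n%:Z) x); rewrite -[nat_of_ord _]/(digit_val (hati (- n%:Z) x)) => hj.
apply: (@leq_trans (p ^ n + digit_val (hati (- n%:Z) x) * p ^ n)).
  by rewrite -addSn leq_add2r.
by rewrite -mulSn leq_mul2r hj orbT.
Qed.

(** The number of unit intervals of the ancestor of level [n] that are to the right
    of the origin, the unit interval [[0, 1)] included. *)
Definition right_len n x : nat := (p ^ n - offset n x)%N.

Lemma right_len_le n x : (right_len n x <= right_len n.+1 x)%N.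
Proof.
rewrite /right_len /offset big_ord_recr /= expnS.
have := ltn_ord (hati (- n%:Z) x); rewrite -[nat_of_ord _]/(digit_val (hati (- n%:Z) x)) => hj.
rewrite [(\sum_(k < n) _ + _)%N]addnC subnDA leq_sub2r// leq_subRL.
  by rewrite addnC -mulSn leq_mul2r hj orbT.
by rewrite leq_mul2r ltnW ?orbT.
Qed.

Definition ancestor_mass n x : R :=
  mass (hatnu x : mstar R) (- (offset n x)%:R) (right_len n x)%:R.
Definition right_mass n x : R := mass (hatnu x : mstar R) 0 (right_len n x)%:R.

Lemma right_len_natr n x : (right_len n x)%:R = (p ^ n)%:R - (offset n x)%:R :> R.
Proof. by rewrite natrB// ltnW// offset_lt. Qed.

(** The ancestor of level [n] becomes the ancestor of level [n + 1] after one step,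
    and its mass is only affected by the normalization. *)
Lemma ancestor_mass_M_p n x : 0 < weight x ->
    ancestor_mass n.+1 (M x) = ancestor_mass n x / weight x.
Proof.
move=> wx; have p0 : p%:R != 0 :> R by rewrite pnatr_eq0 -lt0n ltnW.
have pp : 0 < p%:R :> R by rewrite ltr0n ltnW.
have pushm a b : mass (push_rho (hati 1 x) (hatnu x : mstar R)) a b =
    mass (hatnu x : mstar R) ((a + (hati 1 x : nat)%:R) / p%:R)
                             ((b + (hati 1 x : nat)%:R) / p%:R).
  rewrite /mass pushE//; congr (fine (_ _)); apply/seteqP.
  by split => y; rewrite /= /rho !in_itv/= lerBrDr ltrBlDr ler_pdivrMr// ltr_pdivlMr// mulrC.
have pw : mass (push_rho (hati 1 x) (hatnu x : mstar R)) 0 1 = weight x.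
  by rewrite pushm add0r /weight /cell_mass expn1 nat1r.
rewrite /ancestor_mass right_len_natr [hatnu (M x)]/= nrm_mass pw//.
rewrite pushm offset_M_p right_len_natr natrD natrM expnS natrM.
by congr (mass _ _ _ / _); field.
Qed.

Lemma charged_orbit : {ae Q, forall x,
  (forall k, 0 < weight (iter k M x)) /\ mass (hatnu x : mstar R) 0 1 = 1}.
Proof.
have mW : measurable [set x : Borel (phase R hp) | ~ (0 < weight x)].
  rewrite (_ : [set _ | _] = (@weight R p hp) @^-1` `]-oo, 0]%classic).
    by rewrite -[X in measurable X]setTI; exact: measurable_weight.
  by apply/seteqP; split => x; rewrite /= in_itv/= leNgt => /negP.
have Q0 : Q [set x : Borel (phase R hp) | ~ (0 < weight x)] = 0%E.
  by apply/negligibleP => //; exact: cell_charged.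
have H k : {ae Q, forall x, 0 < weight (iter k M x)}.
  apply/negligibleP; first exact: (measurable_iter_preimage k mW).
  by rewrite -[RHS]Q0; exact: (invariant_iter invQ k mW).
by apply: filterS2 (ae_foralln H) (unit_mass adQ) => x; split.
Qed.

(** After [n] steps, the ancestor of level [n] is the initial unit interval, of mass 1;
    each step has divided its mass by the weight. *)
Lemma ancestor_mass_iter n x : (forall k, 0 < weight (iter k M x)) ->
  mass (hatnu x : mstar R) 0 1 = 1 -> (ancestor_mass n (iter n M x))^-1 = weight_prod n x.
Proof.
move=> wx x1; elim: n => [|n IH].
  by rewrite /ancestor_mass /right_len /offset big_ord0 /weight_prod big_ord0 expn0 oppr0 x1
    invr1.
by rewrite iterS ancestor_mass_M_p// invfM invrK IH /weight_prod big_ord_recr.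
Qed.

(** The share of the ancestor that is to the right of the origin, as a function of
    the offset [l] and of the measure. *)
Definition right_share n l (nu : Borel (mstar R)) : R :=
  mass (nu : mstar R) 0 ((p ^ n)%:R - l%:R) / mass (nu : mstar R) (- l%:R) ((p ^ n)%:R - l%:R).

Lemma measurable_massR a b : measurable_fun setT
    (fun nu : Borel (mstar R) => mass (nu : mstar R) a b).
Proof. by apply: measurableT_comp => //; exact: measurable_mass. Qed.

Lemma measurable_right_share n l : measurable_fun setT (right_share n l).
Proof.
apply: measurable_funM; first exact: measurable_massR.
exact: (measurableT_comp (@measurable_invr R) (measurable_massR _ _)).
Qed.

Lemma measurable_offset_set n (A : nat -> set (Borel (mstar R))) :
  (forall l, measurable (A l)) ->
    measurable [set x : Borel (phase R hp) | A (offset n x) (hatnu x)].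
Proof.
move=> mA; have mF l : measurable_fun setT (EFin \o \1_(A l) : Borel (mstar R) -> \bar R).
  by apply/measurable_EFinP; exact: measurable_indic.
have mO := measurable_offset_funT n mF.
rewrite (_ : [set _ | _] =
    (fun x : Borel (phase R hp) => (\1_(A (offset n x)) (hatnu x) : R)%:E) @^-1` [set 1%E]).
  rewrite -[X in measurable X]setTI.
  by apply: mO => //; exact: emeasurable_set1.
apply/seteqP; split => x /=; rewrite indicE; first by move=> h; rewrite mem_set.
by case: (boolP (_ \in _)) => [/set_mem//|_ [] /eqP]; rewrite eq_sym oner_eq0.
Qed.

Lemma block_prob n (A : nat -> set (Borel (mstar R))) : (forall l, measurable (A l)) ->
  (Q [set x : Borel (phase R hp) | A (offset n x) (hatnu x)] = \int[Q]_x \sum_(l < p ^ n)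
    (cell_mass p n l (hatnu x))%:E * (\1_(A l) (zoom hp n l (hatnu x)))%:E)%E.
Proof.
move=> mA.
rewrite -(block_formula adQ invQ n (F := fun l nu => (\1_(A l) nu)%:E)).
- rewrite -[X in Q X = _]setIT -integral_indic//; last exact: measurable_offset_set.
- by move=> l; apply/measurable_EFinP; exact: measurable_indic.
- by move=> l nu; rewrite lee_fin indicE ler0n.
Qed.

(** Through the block formula, this is the stochastic domination of [tail_sum_le]. *)
Lemma share_prob n (s : R) : 0 <= s ->
  (Q [set x : Borel (phase R hp) | (right_mass n x / ancestor_mass n x <= s)%R] <= s%:E)%E.
Proof.
move=> s0.
have mA l : measurable [set nu | (right_share n l nu <= s)%R].
  rewrite (_ : [set _ | _] = right_share n l @^-1` `]-oo, s]%classic).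
    by rewrite -[X in measurable X]setTI; exact: measurable_right_share.
  by apply/seteqP; split => x; rewrite /= in_itv.
have -> : [set x : Borel (phase R hp) | (right_mass n x / ancestor_mass n x <= s)%R] =
    [set x : Borel (phase R hp) | (right_share n (offset n x) (hatnu x) <= s)%R].
  by apply/seteqP; split => x; rewrite /= /right_mass /ancestor_mass /right_share
    right_len_natr.
rewrite (block_prob n mA).
rewrite (_ : s%:E = \int[Q]_x s%:E)%E; last first.
  by rewrite integral_cst//=; rewrite [X in (_ * X)%E](@probability_setT _ _ _ Q) mule1.
pose F l (nu : Borel (mstar R)) : \bar R :=
  (\1_[set nu | (right_share n l nu <= s)%R] nu : R)%:E.
have F0 l nu : (0 <= F l nu)%E by rewrite lee_fin indicE ler0n.
apply: (@ae_ge0_le_integral _ _ _ Q setT measurableT) => //.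
- by move=> x _; apply: sume_ge0 => l _; rewrite mule_ge0// ?lee_fin ?cell_mass_ge0//;
    exact: F0.
- apply: (measurableT_comp (measurable_block (p := p) hp n (F := F) _)
    (@measurable_hatnu R p hp)).
  by move=> l; apply/measurable_EFinP; exact: measurable_indic.
- apply: filterS (unit_mass adQ) => x x1 _; set nu : mstar R := hatnu x in x1 *.
  rewrite -(big_mkord xpredT (fun l => (cell_mass p n l nu)%:E *
    (\1_[set nu | (right_share n l nu <= s)%R] (zoom hp n l nu) : R)%:E)%E).
  under eq_bigr do rewrite -EFinM.
  rewrite sumEFin lee_fin.
  apply: le_trans (tail_sum_le (c := fun l => cell_mass p n l nu) (p ^ n) _ s0); last first.
    by move=> l; exact: cell_mass_ge0.
  rewrite !big_nat; apply: ler_sum => l /andP[_ lp].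
  have [cl|cl] := ltP 0 (cell_mass p n l nu); last first.
    have -> : cell_mass p n l nu = 0 by apply/eqP; rewrite eq_le cl cell_mass_ge0.
    by rewrite mul0r; case: ifP.
  have pn0 : (p ^ n)%:R != 0 :> R by rewrite pnatr_eq0 -lt0n expn_gt0 (ltnW hp).
  have -> : \sum_(l <= k < p ^ n) cell_mass p n k nu = right_share n l (zoom hp n l nu).
    rewrite cell_mass_sum ?(ltnW lp)// /right_share !zoom_mass//.
    by rewrite add0r subrK addNr mul0r divff// x1 div1r invrK mulfVK ?gt_eqF.
  rewrite indicE; case: (boolP (_ \in _)) => [|_]; last first.
    by rewrite mulr0; case: ifP => // _; exact: cell_mass_ge0.
  by rewrite inE /= mulr1 => ->.
Qed.

Lemma le_measure_ae (A B : set (Borel (phase R hp))) : measurable A -> measurable B ->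
  {ae Q, forall x, A x -> B x} -> (Q A <= Q B)%E.
Proof.
move=> mA mB AB; have mD := measurableD mA mB.
have QD : Q (A `\` B) = 0%E.
  by apply/(negligibleP Q mD); apply: negligibleS AB => x [Ax nBx] /(_ Ax).
rewrite -[leRHS]adde0 -QD; apply: le_trans (measureU2 _ mB mD).
apply: le_measure; rewrite ?inE//; first exact: measurableU.
by move=> x Ax; have [Bx|nBx] := pselect (B x); [left|right].
Qed.

Lemma measurable_le_set (g : nat -> Borel (mstar R) -> R) n (s : R) :
  (forall l, measurable_fun setT (g l)) ->
  measurable [set x : Borel (phase R hp) | g (offset n x) (hatnu x) <= s].
Proof.
move=> mg; apply: (measurable_offset_set n (A := fun l => [set nu | g l nu <= s])) => l.
rewrite (_ : [set _ | _] = g l @^-1` `]-oo, s]%classic).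
  by rewrite -[X in measurable X]setTI; exact: mg.
by apply/seteqP; split => x; rewrite /= in_itv.
Qed.

Lemma measurable_right_mass n C : measurable [set x : Borel (phase R hp) | right_mass n x <= C].
Proof.
have -> : [set x : Borel (phase R hp) | right_mass n x <= C] = [set x : Borel (phase R hp) |
    mass (hatnu x : mstar R) 0 ((p ^ n)%:R - (offset n x)%:R) <= C].
  by apply/seteqP; split => x; rewrite /= /right_mass right_len_natr.
apply: (measurable_le_set (g := fun l (nu : Borel (mstar R)) =>
  mass (nu : mstar R) 0 ((p ^ n)%:R - l%:R))) => l.
exact: measurable_massR.
Qed.

(** A small right part means a small ancestor or a small share of it. *)
Lemma right_mass_prob n (C d : R) : 0 <= C -> 0 < d ->
  (Q [set x : Borel (phase R hp) | (right_mass n x <= C)%R] <=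
   (C * d)%:E + Q [set x | (d <= weight_prod n x)%R])%E.
Proof.
move=> C0 d0.
(* If [d] exceeds the inverse of the mass of the ancestor, then a right part of mass at
   most [C] is a share of at most [C * d]. *)
pose A1 := [set x : Borel (phase R hp) | right_mass n x / ancestor_mass n x <= C * d].
pose A2 := [set x : Borel (phase R hp) | d <= (ancestor_mass n x)^-1].
have mA1 : measurable A1.
  rewrite (_ : A1 = [set x : Borel (phase R hp) | right_share n (offset n x) (hatnu x) <= C *
    d]).
    exact: measurable_le_set (measurable_right_share n).
  by apply/seteqP; split => x; rewrite /A1 /= /right_mass /ancestor_mass /right_share
    right_len_natr.
have mA2 : measurable A2.
  have -> : A2 = [set x : Borel (phase R hp) |
      - (mass (hatnu x : mstar R) (- (offset n x)%:R) ((p ^ n)%:R - (offset n x)%:R))^-1 <= -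
          d].
    by apply/seteqP; split => x; rewrite /A2 /= /ancestor_mass right_len_natr lerN2.
  apply: (measurable_le_set (g := fun l (nu : Borel (mstar R)) =>
    - (mass (nu : mstar R) (- l%:R) ((p ^ n)%:R - l%:R))^-1)) => l.
  apply: measurableT_comp => //.
  exact: (measurableT_comp (@measurable_invr R) (measurable_massR _ _)).
have mW : measurable [set x : Borel (phase R hp) | d <= weight_prod n x].
  rewrite (_ : [set _ | _] = weight_prod (hp := hp) (R := R) n @^-1` `[d, +oo[%classic).
    by rewrite -[X in measurable X]setTI; exact: measurable_weight_prod.
  by apply/seteqP; split => x; rewrite /= in_itv/= andbT.
apply: (@le_trans _ _ (Q A1 + Q A2)%E).
  apply: le_trans (measureU2 _ mA1 mA2).
  apply: le_measure; rewrite ?inE//; first exact: measurable_right_mass.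
    exact: measurableU.
  move=> x /= xC; have [dx|xd] := leP d (ancestor_mass n x)^-1; [by right|left].
  by apply: ler_pM; rewrite ?mass_ge0 ?invr_ge0 ?mass_ge0//; exact: ltW.
apply: leeD; first by apply: share_prob; rewrite mulr_ge0// ltW.
rewrite -(invariant_iter invQ n mA2); apply: le_measure_ae => //.
  exact: measurable_iter_preimage.
by apply: filterS charged_orbit => x [wx x1]; rewrite /A2 /= ancestor_mass_iter.
Qed.

(** Let [n] tend to infinity, and then [d] to 0, in the preceding bound. *)
Lemma right_mass_unbounded : {ae Q, forall x, forall C : R, exists n, C < right_mass n x}.
Proof.
have H (k : nat) : {ae Q, forall x, ~ forall n, right_mass n x <= k%:R}.
  have mZ : measurable (\bigcap_n [set x : Borel (phase R hp) | right_mass n x <= k%:R]).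
    by apply: bigcapT_measurable => n; exact: measurable_right_mass.
  apply: (negligibleS _ ((negligibleP Q mZ).2 _)).
    by move=> x /= /contrapT h n _; exact: h.
  apply/eqP; rewrite eq_le measure_ge0 andbT.
  apply/lee_addgt0Pr => e e0; rewrite add0e.
  (* So that [k%:R * d <= e], also when [k] is 0. *)
  pose d := e / k.+1%:R; have d0 : 0 < d by rewrite divr_gt0.
  have kd : k%:R * d <= e.
    by rewrite /d mulrCA ler_piMr ?(ltW e0)// ler_pdivrMr// mul1r ler_nat.
  have cv := weight_prod_prob adQ invQ ergQ ndQ d0.
  have cv' : ((k%:R * d)%:E + Q [set x | (d <= weight_prod n x)%R] @[n --> \oo] -->
      (k%:R * d)%:E + 0)%E.
    by apply: cvgeD => //; exact: cvg_cst.
  rewrite adde0 in cv'.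
  apply: (@le_trans _ _ (k%:R * d)%:E); last by rewrite lee_fin.
  apply: (cvge_to_ge cv'); apply: nearW => n.
  apply: le_trans (right_mass_prob n (ler0n _ _) d0).
  by apply: le_measure; rewrite ?inE//; [exact: measurable_right_mass|move=> x /(_ n I)].
apply: filterS (ae_foralln H) => x xk C.
have [k Ck] : exists k : nat, C < k%:R.
  by exists (Num.bound `|C|); apply: le_lt_trans (ler_norm C) _; exact: archi_boundP.
apply: contrapT => nC; apply: (xk k) => n; rewrite leNgt; apply/negP => kn.
by apply: nC; exists n; exact: lt_trans kn.
Qed.

End escape.

(** * The maximal inequality *)

Section rising_sun.
Variable R : realDomainType.
Variables (a : nat -> R) (L : nat).

(** Some partial sum started at [l] and staying below [L] is positive. *)
Definition rises l : bool :=
  `[< exists N, (l + N <= L)%N /\ 0 < \sum_(l <= k < l + N) a k >].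

(** The claim for all [N] at once is proved backwards from the end.  At a position
    that rises, each partial sum is its first term plus a partial sum from the next
    position; at the others, all the partial sums are nonpositive. *)
Lemma rising_sun_le m l N : (l + m = L)%N -> (N <= m)%N ->
  \sum_(l <= k < l + N) a k <= \sum_(l <= j < L) (if rises j then a j else 0).
Proof.
elim: m l N => [|m IH] l N lmL.
  by rewrite leqn0 => /eqP ->; rewrite -lmL !addn0 !big_geq.
have lm1 : (l.+1 + m = L)%N by rewrite addSnnS.
have G0 : 0 <= \sum_(l.+1 <= j < L) (if rises j then a j else 0).
  by have := IH l.+1 0%N lm1 (leq0n _); rewrite addn0 big_geq.
rewrite [leRHS]big_ltn; last by rewrite -lm1 leq_addr.
have step K : (K <= m)%N -> \sum_(l <= k < l + K.+1) a k <=
    a l + \sum_(l.+1 <= j < L) (if rises j then a j else 0).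
  have lK : (l < l + K.+1)%N by rewrite addnS ltnS leq_addr.
  move=> Km; rewrite (big_ltn lK).
  by rewrite lerD2l -addSnnS; exact: IH.
case: ifPn => [/asboolP[K [KL K0]] NM|nl].
  have Gl : 0 <= a l + \sum_(l.+1 <= j < L) (if rises j then a j else 0).
    case: K => [|K] in KL K0 *; first by rewrite addn0 big_geq// ltxx in K0.
    apply: le_trans (ltW K0) (step _ _).
    by rewrite -(leq_add2l l.+1) lm1 addSnnS.
  by case: N NM => [|N] NM; [rewrite addn0 [leLHS]big_geq|exact: (step _ NM)].
move=> NM; rewrite add0r; apply: le_trans G0; rewrite leNgt; apply/negP => N0.
by move/asboolP: nl; apply; exists N; split => //; rewrite -lmL leq_add2l.
Qed.

Lemma rising_sun : 0 <= \sum_(0 <= j < L) (if rises j then a j else 0).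
Proof. by have := @rising_sun_le L 0 0 (add0n L) (leq0n _); rewrite big_geq. Qed.

End rising_sun.

Section law.
Context {R : realType} (p : nat) (hp : (2 <= p)%N) (Q : probability (Borel (phase R hp)) R).
Hypotheses (adQ : adapted Q) (invQ : Defs.invariant Q) (ergQ : ergodic Q).
Hypothesis ndQ : ~ deterministic Q.

Local Notation mu := (nu_law Q).
Implicit Types (x : Borel (phase R hp)) (nu : Borel (mstar R)).

Definition unit_cell (k : nat) nu : R := mass (nu : mstar R) k%:R k.+1%:R.

Lemma measurable_unit_cell k : measurable_fun setT (unit_cell k).
Proof. exact: measurable_massR. Qed.

Lemma unit_cell_zoom n l k (nu : mstar R) : mass nu 0 1 = 1 -> (l < p ^ n)%N ->
    0 < cell_mass p n l nu ->
  unit_cell k (zoom hp n l nu) = cell_mass p n (l + k) nu / cell_mass p n l nu.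
Proof.
by move=> nu1 ln cl; rewrite /unit_cell zoom_mass// -!natrD addnC addSn [(k + l)%N]addnC.
Qed.

Lemma right_len_unbounded : {ae Q, forall x, forall K : nat, exists n, (K <= right_len n x)%N}.
Proof.
apply: filterS (right_mass_unbounded adQ invQ ergQ ndQ) => x rx K.
have [n Kn] := rx (mass (hatnu x : mstar R) 0 K%:R).
exists n; rewrite leqNgt; apply/negP => nK; move: Kn; rewrite ltNge => /negP; apply.
by apply: mass_le => //; rewrite ler_nat ltnW.
Qed.

(** An event that depends on the measure only has the same probability under both
    laws; measurability rules out null sets that involve the digits. *)
Lemma ae_law (P : set (Borel (mstar R))) : measurable P ->
  {ae Q, forall x, P (hatnu x)} -> {ae mu, forall nu, P nu}.
Proof.
move=> mP PQ; apply/negligibleP; first exact: measurableC.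
have mPQ : measurable (hatnu @^-1` (~` P) : set (Borel (phase R hp))).
  rewrite -[X in measurable X]setTI; apply: (@measurable_hatnu R p hp) => //.
  exact: measurableC.
exact: (negligibleP Q mPQ).1.
Qed.

Lemma mass_unbounded : {ae mu, forall nu, forall C : R, exists N,
    C < mass (nu : mstar R) 0 N%:R}.
Proof.
have mB (k : nat) : measurable (\bigcup_N
    [set nu : Borel (mstar R) | k%:R < mass (nu : mstar R) 0 N%:R]).
  apply: bigcupT_measurable => N.
  rewrite (_ : [set _ | _] = (fun nu => mass (nu : mstar R) 0 N%:R) @^-1` `]k%:R, +oo[%classic).
    by rewrite -[X in measurable X]setTI; exact: measurable_massR.
  by apply/seteqP; split => x; rewrite /= in_itv/= andbT.
have H (k : nat) : {ae mu, forall nu,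
    (\bigcup_N [set nu : Borel (mstar R) | k%:R < mass (nu : mstar R) 0 N%:R]) nu}.
  apply: ae_law => //; apply: filterS (right_mass_unbounded adQ invQ ergQ ndQ) => x rx.
  by have [n kn] := rx k%:R; exists (right_len n x).
apply: filterS (ae_foralln H) => nu nuk C.
have [k Ck] : exists k : nat, C < k%:R.
  by exists (Num.bound `|C|); apply: le_lt_trans (ler_norm C) _; exact: archi_boundP.
by have [N _ /= kN] := nuk k; exists N; exact: lt_trans kN.
Qed.

Lemma ge0_integral_law (g : Borel (mstar R) -> \bar R) : measurable_fun setT g ->
  (forall nu, 0 <= g nu)%E -> (\int[mu]_nu g nu = \int[Q]_x g (hatnu x))%E.
Proof. by move=> mg g0; rewrite ge0_integral_distribution. Qed.

(** In the block formula, a bad translate of a zoom is a zoom into another charged cell,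
    and almost surely no charged cell zooms into the null set. *)
Lemma tstar_nonsingular (N : set (Borel (mstar R))) : mu.-negligible N ->
  {ae mu, forall nu, forall k, 0 < unit_cell k nu -> ~ N (tstar k%:R nu)}.
Proof.
move=> [N' [mN' N'0 NN']].
apply: ae_foralln => k.
pose Bad : set (Borel (mstar R)) :=
  [set nu : Borel (mstar R) | 0 < unit_cell k nu /\ N' (tstar k%:R nu)].
have mBad : measurable Bad.
  rewrite (_ : Bad = unit_cell k @^-1` `]0, +oo[%classic `&` (@tstar R k%:R) @^-1` N').
    apply: measurableI; rewrite -[X in measurable X]setTI.
      exact: measurable_unit_cell.
    exact: (measurable_tstar k%:R).
  by apply/seteqP; split => x; rewrite /Bad /= in_itv/= andbT.
have badae : {ae mu, forall nu, (~` Bad) nu}.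
  apply: ae_law; first exact: measurableC.
  (* The bad translate is required to stay inside the ancestor of level [n]; every
     translate does so for large [n]. *)
  pose A n l : set (Borel (mstar R)) :=
    [set nu : Borel (mstar R) | (k + l < p ^ n)%N /\ Bad nu].
  have mA n l : measurable (A n l).
    have [kl|kl] := boolP (k + l < p ^ n)%N.
      by rewrite (_ : A n l = Bad)//; apply/seteqP; split => nu // [].
    rewrite (_ : A n l = set0)//; apply/seteqP; split => // nu [kl'].
    by rewrite kl' in kl.
  have QA n : Q [set x : Borel (phase R hp) | A n (offset n x) (hatnu x)] = 0%E.
    rewrite (block_prob adQ invQ n (mA n)).
    pose F (l : nat) nu : \bar R := (\1_N' nu : R)%:E.
    have mF l : measurable_fun setT (F l) by apply/measurable_EFinP; exact: measurable_indic.
    have F0 l nu : (0 <= F l nu)%E by rewrite lee_fin indicE ler0n.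
    have := block_formula adQ invQ n mF F0.
    have -> : (\int[Q]_x F (offset n x) (hatnu x) = 0)%E.
      have <- : (\int[mu]_nu F 0%N nu = 0)%E by rewrite /F integral_indic// setIT.
      by rewrite ge0_integral_law.
    pose blk x := (\sum_(l < p ^ n) (cell_mass p n l (hatnu x))%:E * F l
      (zoom hp n l (hatnu x)))%E.
    have mblk : measurable_fun setT blk.
      exact: (measurableT_comp (measurable_block hp n mF) (@measurable_hatnu R p hp)).
    have blk0 x : (0 <= blk x)%E.
      by apply: sume_ge0 => l _; rewrite mule_ge0// lee_fin cell_mass_ge0.
    move=> /esym blkint.
    have aeblk : {ae Q, forall x, blk x = 0%E}.
      have := (@ae_eq_integral_abs _ _ _ Q setT measurableT blk mblk).1.
      have -> : (\int[Q]_x `|blk x| = 0)%E.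
        by rewrite -[RHS]blkint; apply: eq_integral => x _; rewrite gee0_abs.
      by move=> /(_ erefl); apply: filterS => x; exact.
    rewrite -[RHS](integral0 Q setT); apply: ae_eq_integral => //.
      pose G l nu : \bar R := (\1_(A n l) nu : R)%:E.
      have mG l : measurable_fun setT (G l).
        by apply/measurable_EFinP; exact: measurable_indic.
      exact: (measurableT_comp (measurable_block hp n mG) (@measurable_hatnu R p hp)).
    apply: filterS2 aeblk (unit_mass adQ) => x bx x1 _ /=.
    set nu : mstar R := hatnu x in bx x1 *.
    apply: big1 => l _.
    have [cl|cl] := ltP 0 (cell_mass p n l nu); last first.
      have -> : cell_mass p n l nu = 0 by apply/eqP; rewrite eq_le cl cell_mass_ge0.
      by rewrite mul0e.
    rewrite indicE; case: (boolP (_ \in _)) => [|_]; last by rewrite mule0.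
    rewrite inE => -[/= kl [+ Nk]]; rewrite unit_cell_zoom// => ckl.
    have ckl0 : 0 < cell_mass p n (l + k) nu.
      by move: ckl; rewrite pmulr_lgt0// invr_gt0.
    rewrite addnC in kl; rewrite tstar_zoom// in Nk.
    move/eqP: bx; rewrite /blk seq_psume_eq0; last first.
      by move=> j _; rewrite mule_ge0// lee_fin cell_mass_ge0.
    move=> /allP /(_ (Ordinal kl) (mem_index_enum _)) /=.
    by rewrite -/nu /F indicE mem_set// mule1 eqe gt_eqF.
  have HA n : {ae Q, forall x, ~ A n (offset n x) (hatnu x)}.
    have mAn : measurable [set x : Borel (phase R hp) | A n (offset n x) (hatnu x)].
      exact: measurable_offset_set (mA n).
    have nAn := (negligibleP Q mAn).2 (QA n).
    by apply: negligibleS nAn => x /= /contrapT.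
  apply: filterS2 (ae_foralln HA) right_len_unbounded => x nA lx bad.
  have [n kn] := lx k.+1; apply: (nA n); split => //.
  by rewrite addnC -ltn_subRL.
apply: filterS badae => nu nbad uk Nk; apply: nbad; split => //; exact: NN'.
Qed.

Definition weighted_sum (F : Borel (mstar R) -> R) (N : nat) nu : R :=
  \sum_(0 <= k < N) unit_cell k nu * F (tstar k%:R nu).

Lemma measurable_weighted_sum F N : measurable_fun setT F ->
    measurable_fun setT (weighted_sum F N).
Proof.
move=> mF; apply: measurable_sum => k; apply: measurable_funM.
  exact: measurable_unit_cell.
exact: (measurableT_comp mF (measurable_tstar k%:R)).
Qed.

Lemma weighted_sum_zoom F N n l (nu : mstar R) : mass nu 0 1 = 1 -> (l + N <= p ^ n)%N ->
  0 < cell_mass p n l nu -> weighted_sum F N (zoom hp n l nu) =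
  (cell_mass p n l nu)^-1 * \sum_(l <= k < l + N) cell_mass p n k nu * F (zoom hp n k nu).
Proof.
move=> nu1 lN cl; rewrite /weighted_sum.
pose G k := cell_mass p n k nu * F (zoom hp n k nu).
rewrite [X in _ * X](_ : _ = \sum_(0 <= k < N) G (k + l)%N); last first.
  by rewrite -[LHS]/(\sum_(0 + l <= k < l + N) G k) big_addn addKn.
rewrite /G big_distrr !big_nat /=.
case: N lN => [|N] lN; first by rewrite !big_geq.
apply: eq_bigr => k kN.
have lk : (l + k < p ^ n)%N by apply: leq_trans lN; rewrite ltn_add2l.
have ln : (l < p ^ n)%N by apply: leq_ltn_trans lk; rewrite leq_addr.
rewrite unit_cell_zoom// [(k + l)%N]addnC.
have [ck|ck] := ltP 0 (cell_mass p n (l + k) nu).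
  by rewrite tstar_zoom// mulrAC mulrC.
have -> : cell_mass p n (l + k) nu = 0 by apply/eqP; rewrite eq_le ck cell_mass_ge0.
by rewrite !mul0r mulr0.
Qed.

Definition rising (F : Borel (mstar R) -> R) (L : nat) : set (Borel (mstar R)) :=
  \bigcup_(N in [set N | (N <= L)%N]) [set nu | 0 < weighted_sum F N nu].

Lemma measurable_rising F L : measurable_fun setT F -> measurable (rising F L).
Proof.
move=> mF; apply: bigcup_measurable => N _.
rewrite (_ : [set _ | _] = weighted_sum F N @^-1` `]0, +oo[%classic).
  by rewrite -[X in measurable X]setTI; exact: measurable_weighted_sum.
by apply/seteqP; split => nu; rewrite /= in_itv/= andbT.
Qed.

(** Inside an ancestor, the weighted sums are, up to the mass of the present cell, the
    partial sums of a finite sequence indexed by the cells. *)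
Lemma block_rising (F : Borel (mstar R) -> R) n l (nu : mstar R) : mass nu 0 1 = 1 ->
  (l < p ^ n)%N -> 0 < cell_mass p n l nu ->
  zoom hp n l nu \in rising F (p ^ n - l) =
  rises (fun k => cell_mass p n k nu * F (zoom hp n k nu)) (p ^ n) l.
Proof.
move=> nu1 ln cl; apply/idP/idP => [/set_mem[N /= NL]|/asboolP[N [NL S0]]].
  have lN : (l + N <= p ^ n)%N by rewrite -leq_subRL// ltnW.
  rewrite weighted_sum_zoom// pmulr_rgt0 ?invr_gt0// => S0.
  by apply/asboolP; exists N.
apply/mem_set; exists N => /=; first by rewrite leq_subRL// ltnW.
by rewrite weighted_sum_zoom// pmulr_rgt0 ?invr_gt0.
Qed.

(** The block formula applied to the positive and to the negative part; the
    difference is the sum bounded below in [rising_sun]. *)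
Lemma rising_block_le (F : Borel (mstar R) -> R) n : measurable_fun setT F ->
  (\int[Q]_(x in [set x | rising F (right_len n x) (hatnu x)]) ((EFin \o F)^\- (hatnu x)) <=
   \int[Q]_(x in [set x | rising F (right_len n x) (hatnu x)]) ((EFin \o F)^\+ (hatnu x)))%E.
Proof.
move=> mF.
have mEF : measurable_fun setT (EFin \o F) by exact/measurable_EFinP.
have mr l : measurable (rising F (p ^ n - l)) by exact: measurable_rising.
have ind (g : Borel (mstar R) -> \bar R) : measurable_fun setT g -> (forall nu, 0 <= g nu)%E ->
  (\int[Q]_(x in [set x | rising F (right_len n x) (hatnu x)]) g (hatnu x) =
   \int[Q]_x \sum_(l < p ^ n) (cell_mass p n l (hatnu x))%:E *
     ((\1_(rising F (p ^ n - l)) (zoom hp n l (hatnu x)))%:E * g (zoom hp n l (hatnu x))))%E.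
  move=> mg g0.
  pose G l nu : \bar R := ((\1_(rising F (p ^ n - l)) nu : R)%:E * g nu)%E.
  have mG l : measurable_fun setT (G l).
    by apply: emeasurable_funM => //; apply/measurable_EFinP; exact: measurable_indic.
  have G0 l nu : (0 <= G l nu)%E by rewrite mule_ge0// lee_fin indicE ler0n.
  rewrite -(block_formula adQ invQ n mG G0) integral_mkcond; apply: eq_integral => x _.
  rewrite patchE /G indicE.
  rewrite (_ : (x \in _) = (hatnu x \in rising F (p ^ n - offset n x))).
    by case: ifP => _; rewrite ?mul1e ?mul0e.
  by apply/idP/idP; rewrite !inE.
have posE nu : (EFin \o F)^\+%E nu = (Num.max (F nu) 0)%:E by rewrite funeposE EFin_max.
have negE nu : (EFin \o F)^\-%E nu = (Num.max (- F nu) 0)%:E by rewrite funenegE EFin_max.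
have sub_max (t : R) : Num.max t 0 - Num.max (- t) 0 = t.
  by have [h|h] := leP t 0; have [h'|h'] := leP (- t) 0; lra.
have mint (g : Borel (mstar R) -> \bar R) : measurable_fun setT g ->
    measurable_fun setT (fun x => \sum_(l < p ^ n) (cell_mass p n l (hatnu x))%:E *
     ((\1_(rising F (p ^ n - l)) (zoom hp n l (hatnu x)))%:E * g (zoom hp n l (hatnu x))))%E.
  move=> mg; pose G l nu : \bar R := ((\1_(rising F (p ^ n - l)) nu : R)%:E * g nu)%E.
  have mG l : measurable_fun setT (G l).
    by apply: emeasurable_funM => //; apply/measurable_EFinP; exact: measurable_indic.
  exact: (measurableT_comp (measurable_block hp n mG) (@measurable_hatnu R p hp)).
have mp := measurable_funepos mEF; have mn := measurable_funeneg mEF.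
rewrite !ind//.
apply: (@ae_ge0_le_integral _ _ _ Q setT measurableT); [|exact: mint| |exact: mint|].
- by move=> x _; apply: sume_ge0 => l _;
    rewrite !mule_ge0// ?lee_fin ?cell_mass_ge0// indicE ler0n.
- by move=> x _; apply: sume_ge0 => l _;
    rewrite !mule_ge0// ?lee_fin ?cell_mass_ge0// indicE ler0n.
apply: filterS (unit_mass adQ) => x x1 _; set nu : mstar R := hatnu x in x1 *.
under eq_bigr do rewrite negE -!EFinM.
under [leRHS]eq_bigr do rewrite posE -!EFinM.
rewrite !sumEFin lee_fin -subr_ge0 -sumrB.
apply: le_trans (rising_sun (fun k => cell_mass p n k nu * F (zoom hp n k nu)) (p ^ n)) _.
rewrite big_mkord; apply: ler_sum => l _.
have [cl|cl] := ltP 0 (cell_mass p n l nu); last first.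
  have -> : cell_mass p n l nu = 0 by apply/eqP; rewrite eq_le cl cell_mass_ge0.
  by rewrite !mul0r subrr; case: ifP.
rewrite indicE block_rising//; case: ifP => _; last by rewrite !mul0r !mulr0 subrr.
rewrite !mul1r -mulrBr ler_pM2l//.
by rewrite sub_max.
Qed.

(** The ancestors exhaust the half-line, so that the events in which the partial sums
    are required to stay in the ancestor increase to the unconstrained one. *)
Lemma half_line_maximal_inequality (F : Borel (mstar R) -> R) :
    mu.-integrable setT (EFin \o F) ->
  (0 <= \int[mu]_(nu in \bigcup_N [set nu | (0 < weighted_sum F N nu)%R]) (F nu)%:E)%E.
Proof.
move=> intF; have mEF := measurable_int mu intF.
have mF : measurable_fun setT F by exact/measurable_EFinP.
set D := \bigcup_N _.
have mD : measurable D.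
  apply: bigcupT_measurable => N.
  rewrite (_ : [set _ | _] = weighted_sum F N @^-1` `]0, +oo[%classic).
    by rewrite -[X in measurable X]setTI; exact: measurable_weighted_sum.
  by apply/seteqP; split => nu; rewrite /= in_itv/= andbT.
(* The events of [rising_block_le], which increase to the preimage of [D] up to a null
   set. *)
pose U n : set (Borel (phase R hp)) := [set x | rising F (right_len n x) (hatnu x)].
have mU n : measurable (U n).
  apply: (measurable_offset_set n (A := fun l => rising F (p ^ n - l))) => l.
  exact: measurable_rising.
have ndU : nondecreasing_seq U.
  apply/nondecreasing_seqP => n; apply/subsetPset => x [N /= NL S0].
  by exists N => //=; exact: leq_trans NL (right_len_le n x).
have mcomp g : measurable_fun setT g ->
    measurable_fun setT (fun x : Borel (phase R hp) => g (hatnu x) : \bar R).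
  by move=> mg; exact: (measurableT_comp mg (@measurable_hatnu R p hp)).
have limU g : measurable_fun setT g -> (forall nu, 0 <= g nu)%E ->
    (\int[Q]_(x in U n) g (hatnu x) @[n --> \oo] --> \int[mu]_(nu in D) g nu)%E.
  move=> mg g0; have mQ := mcomp _ mg.
  rewrite (_ : (\int[mu]_(nu in D) g nu = \int[Q]_(x in \bigcup_n U n) g (hatnu x))%E).
    apply: ge0_nondecreasing_set_cvg_integral => // n.
    exact: measurable_funTS.
  rewrite (@ge0_integral_pushforward _ _ _ _ R hatnu (@measurable_hatnu R p hp) Q D g mD
    (measurable_funTS mg) (fun nu _ => g0 nu)).
  have mhD : measurable (hatnu @^-1` D : set (Borel (phase R hp))).
    by rewrite -[X in measurable X]setTI; exact: (@measurable_hatnu R p hp).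
  have mUU : measurable (\bigcup_n U n) by exact: bigcupT_measurable.
  rewrite [LHS]integral_mkcond [RHS]integral_mkcond; apply: ae_eq_integral => //.
  - by apply/(measurable_restrictT _ mhD); exact: measurable_funTS.
  - by apply/(measurable_restrictT _ mUU); exact: measurable_funTS.
  apply: filterS right_len_unbounded => x lx _; rewrite !patchE.
  rewrite (_ : (x \in hatnu @^-1` D) = (x \in \bigcup_n U n))//.
  apply/idP/idP; rewrite !inE => -[N].
    by move=> _ S0; have [n Nn] := lx N; exists n => //; exists N.
  by move=> _ [K _ S0]; exists K.
have mp := measurable_funepos mEF; have mn := measurable_funeneg mEF.
have intFD : mu.-integrable D (EFin \o F) by exact: integrableS intF.
rewrite [leRHS](_ : _ = \int[mu]_(nu in D) (EFin \o F) nu)%E// integralE.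
rewrite sube_ge0; last first.
  by apply/orP; left; apply: integrable_fin_num => //; exact: integrable_funeneg.
apply: lee_cvg_to (limU _ mn _) (limU _ mp _) _ => //.
by apply: nearW => n; exact: rising_block_le.
Qed.

End law.

(** * Translations at charged cells *)

Section invariance.
Context {R : realType}.
Implicit Type nu : mstar R.

Lemma unit_cellE k nu : unit_cell k nu = mass nu k%:R (1 + k%:R).
Proof. by rewrite /unit_cell nat1r. Qed.

Lemma unit_cell_ge0 k nu : 0 <= unit_cell k nu. Proof. exact: mass_ge0. Qed.

Lemma sum_unit_cell N nu : \sum_(0 <= k < N) unit_cell k nu = mass nu 0 N%:R.
Proof.
elim: N => [|N IH]; first by rewrite big_geq// /mass set_itvco0 measure0.
by rewrite big_nat_recr//= IH -massD// ler_nat.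
Qed.

Lemma unit_cell_tstar k l nu : 0 < unit_cell k nu ->
  unit_cell l (tstar k%:R nu) = unit_cell (k + l) nu / unit_cell k nu.
Proof.
move=> ck; rewrite {1}/unit_cell tstar_mass; last by rewrite -unit_cellE.
by rewrite -unit_cellE -!natrD addSn [(l + k)%N]addnC.
Qed.

Lemma tstar_tstar k l nu : 0 < unit_cell k nu -> 0 < unit_cell (k + l) nu ->
  tstar l%:R (tstar k%:R nu) = tstar (k + l)%:R nu.
Proof. by move=> ck ckl; rewrite natrD tstarD// -?natrD -unit_cellE. Qed.

Lemma tstar0 nu : mass nu 0 1 = 1 -> tstar 0 nu = nu.
Proof.
move=> nu1; apply: mstar_eq => A mA; rewrite tstarE// ?addr0 ?nu1// invr1 mul1e.
by congr (nu _); apply/seteqP; split => y; rewrite /= /tr subr0.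
Qed.

Lemma return_timesE nu n : return_times nu n <-> (1 <= n)%N /\ 0 < unit_cell n nu.
Proof.
have E : translate n%:R nu `[0%R, 1%R[%classic = (unit_cell n nu)%:E.
  by rewrite massE translate_mass add0r -unit_cellE.
by rewrite -lte_fin -E.
Qed.

Lemma tmap_charged nu : return_times nu !=set0 ->
  0 < unit_cell (tau nu) nu /\ tmap nu = tstar (tau nu)%:R nu.
Proof. by move=> /min_natP[/return_timesE[_ ?] _]. Qed.

(** The return time of a translate leads to the next charged cell. *)
Lemma tmap_tstar j k nu : (j < k)%N -> 0 < unit_cell j nu -> 0 < unit_cell k nu ->
  (forall m, (j < m < k)%N -> unit_cell m nu <= 0) ->
  tmap (tstar j%:R nu) = tstar k%:R nu.
Proof.
move=> jk cj ck gap.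
have jkE : (j + (k - j))%N = k by rewrite subnKC// ltnW.
rewrite /tmap (_ : tau _ = (k - j)%N); first by rewrite tstar_tstar ?jkE.
apply: min_nat_eq.
  apply/return_timesE; split; first by rewrite subn_gt0.
  by rewrite unit_cell_tstar// jkE divr_gt0.
move=> m /return_timesE[m0]; rewrite unit_cell_tstar// pmulr_lgt0 ?invr_gt0// => cm.
rewrite leqNgt; apply/negP => mk; move: cm; rewrite ltNge => /negP; apply.
by apply: gap; rewrite -{1}[j]addn0 ltn_add2l m0 -ltn_subRL.
Qed.

(** By induction along the charged cells, keeping track of the last one so far. *)
Lemma tstar_invariant (g : mstar R -> R) nu : mass nu 0 1 = 1 ->
  (forall k, 0 < unit_cell k nu -> g (tmap (tstar k%:R nu)) = g (tstar k%:R nu)) ->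
  forall k, 0 < unit_cell k nu -> g (tstar k%:R nu) = g nu.
Proof.
move=> nu1 gt.
(* [j] is the last charged cell up to [k]. *)
have H k : exists j, [/\ (j <= k)%N, 0 < unit_cell j nu, g (tstar j%:R nu) = g nu &
    forall m, (j < m <= k)%N -> unit_cell m nu <= 0].
  elim: k => [|k [j [jk cj gj gap]]].
    exists 0%N; split => //; first by rewrite /unit_cell nu1.
      by rewrite tstar0.
    by move=> m /andP[m0]; rewrite leqNgt m0.
  have [ck|ck] := ltP 0 (unit_cell k.+1 nu); last first.
    exists j; split => //; first exact: leqW.
    move=> m /andP[jm]; rewrite leq_eqVlt => /predU1P[->//|mk].
    by apply: gap; rewrite jm.
  exists k.+1; split => //; last by move=> m /andP[km]; rewrite leqNgt km.
  by rewrite -(@tmap_tstar j k.+1)// gt.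
move=> k ck; have [j [jk cj gj gap]] := H k.
move: jk; rewrite leq_eqVlt => /predU1P[<-//|jk].
by have := gap k; rewrite jk leqnn leNgt ck => /(_ isT).
Qed.

Lemma weighted_sum_tstar (F : Borel (mstar R) -> R) N k nu : 0 < unit_cell k nu ->
  weighted_sum F N (tstar k%:R nu) = (unit_cell k nu)^-1 *
    (weighted_sum F (k + N) nu - weighted_sum F k nu).
Proof.
move=> ck; rewrite /weighted_sum.
rewrite [X in _ * (X - _)](big_cat_nat (leq0n k) (leq_addr N k)) addrAC subrr add0r.
rewrite [X in _ * X](_ : _ = \sum_(0 <= l < N) unit_cell (l + k) nu * F (tstar (l + k)%:R nu)).
  2: by rewrite -[LHS]/(\sum_(0 + k <= l < k + N) unit_cell l nu * F (tstar l%:R nu)) big_addn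
    addKn.
rewrite big_distrr /=.
apply: eq_bigr => l _; rewrite unit_cell_tstar// [(l + k)%N]addnC.
have [ckl|ckl] := ltP 0 (unit_cell (k + l) nu).
  by rewrite tstar_tstar// mulrAC mulrC.
have -> : unit_cell (k + l) nu = 0 by apply/eqP; rewrite eq_le ckl unit_cell_ge0.
by rewrite !mul0r mulr0.
Qed.

(** Unlike conditions on the limit of the averages, this one is exactly invariant
    under translations to charged cells: the sums change by an additive constant and a
    positive factor. *)
Definition unbounded_sums (F : Borel (mstar R) -> R) : set (Borel (mstar R)) :=
  [set nu | forall C : nat, exists N, C%:R < weighted_sum F N nu].

Lemma unbounded_sumsP F nu :
  unbounded_sums F nu <-> forall C : R, exists N, C < weighted_sum F N nu.
Proof.
split => unb C; last exact: unb.
have [N CN] := unb (Num.bound `|C|); exists N; apply: lt_trans CN.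
exact: le_lt_trans (ler_norm C) (archi_boundP (normr_ge0 C)).
Qed.

Lemma unbounded_sums_tstar F k nu : 0 < unit_cell k nu ->
  unbounded_sums F (tstar k%:R nu) <-> unbounded_sums F nu.
Proof.
move=> ck; split => /unbounded_sumsP unb; apply/unbounded_sumsP => C.
  have [N] := unb ((unit_cell k nu)^-1 * (C - weighted_sum F k nu)).
  rewrite weighted_sum_tstar// ltr_pM2l ?invr_gt0// ltrD2r => CN.
  by exists (k + N)%N.
(* A bound that the sums of fewer than [k] terms cannot exceed. *)
pose B := \sum_(0 <= i < k) `|weighted_sum F i nu|.
have [N] := unb (`|unit_cell k nu * C + weighted_sum F k nu| + B).
have [Nk|kN] := ltnP N k.
  have : weighted_sum F N nu <= B.
    rewrite /B (bigD1_seq N) ?mem_index_iota ?iota_uniq//=.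
    by rewrite (le_trans (ler_norm _))// lerDl sumr_ge0.
  have := normr_ge0 (unit_cell k nu * C + weighted_sum F k nu); lra.
have B0 : 0 <= B by apply: sumr_ge0.
have := ler_norm (unit_cell k nu * C + weighted_sum F k nu) => h1 h2.
exists (N - k)%N; rewrite weighted_sum_tstar// subnKC// mulrC ltr_pdivlMr// ltrBrDr.
by rewrite mulrC; lra.
Qed.

Lemma measurable_unbounded_sums F : measurable_fun setT F -> measurable (unbounded_sums F).
Proof.
move=> mF; rewrite (_ : unbounded_sums F =
    \bigcap_(C : nat) \bigcup_N (weighted_sum F N @^-1` `]C%:R, +oo[%classic)).
  apply: bigcapT_measurable => C; apply: bigcupT_measurable => N.
  by rewrite -[X in measurable X]setTI; exact: measurable_weighted_sum.
apply/seteqP; split => nu unb C.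
  by move=> _; have [N CN] := unb C; exists N => //; rewrite /= in_itv/= CN.
by have [N _ /=] := unb C I; rewrite in_itv/= andbT; exists N.
Qed.

Lemma weighted_sum_restrict F (A : set (Borel (mstar R))) N nu :
  (forall k, 0 < unit_cell k nu -> A (tstar k%:R nu) <-> A nu) ->
  weighted_sum (fun nu => F nu * \1_A nu) N nu = weighted_sum F N nu * \1_A nu.
Proof.
move=> invA; rewrite /weighted_sum big_distrl /=; apply: eq_bigr => k _.
have [ck|ck] := ltP 0 (unit_cell k nu).
  rewrite mulrA !indicE; congr (_ * (nat_of_bool _)%:R).
  by apply/idP/idP; rewrite !inE => /(invA k ck).
have -> : unit_cell k nu = 0 by apply/eqP; rewrite eq_le ck unit_cell_ge0.
by rewrite !mul0r.
Qed.

End invariance.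

(** * The sigma-algebra of invariant sets *)

Section invariant_sets.
Context {R : realType} (P : probability (Borel (mstar R)) R).
Hypothesis returnP : {ae P, forall nu : Borel (mstar R), return_times nu !=set0}.

(** Where the return map is almost surely defined, invariance modulo null sets is the
    almost sure equivalence of [A nu] and [A (tmap nu)]. *)
Lemma invariant_setsP (A : set (Borel (mstar R))) :
  invariant_sets P A <->
  measurable A /\ {ae P, forall nu : Borel (mstar R), A nu <-> A (tmap nu)}.
Proof.
split => -[mA nA]; split => //.
  have nA' : {ae P, forall nu : Borel (mstar R),
      ~ (A `+` (tmap_preimage A : set (Borel (mstar R)))) nu}.
    by apply: negligibleS nA => nu /= /contrapT.
  apply: filterS2 returnP nA' => nu r nu_nA; split => h; apply: contrapT => nh.
    by apply: nu_nA; left; split => // -[].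
  by apply: nu_nA; right; split.
have : P.-negligible (~` [set nu :
    Borel (mstar R) | (A nu <-> A (tmap nu)) /\ return_times nu !=set0]).
  by apply: filterI nA returnP.
apply: negligibleS => nu [[Anu nA']|[[r Atnu] nAnu]] [AA r'] /=.
  by apply: nA'; split => //; exact/AA.
exact/nAnu/AA.
Qed.

Lemma invariant_sets_sigma : sigma_algebra setT (invariant_sets P).
Proof.
split.
- by apply/invariant_setsP; split => //; exact: aeW.
- move=> A /invariant_setsP[mA iA]; apply/invariant_setsP; split.
    by apply: measurableD.
  by apply: filterS iA => nu [h1 h2]; split => -[_ nA]; split => //; [move=> /h2|move=> /h1].
- move=> A iA; apply/invariant_setsP; split.
    by apply: bigcupT_measurable => n; have [] := iA n.
  have H n : {ae P, forall nu : Borel (mstar R), A n nu <-> A n (tmap nu)}.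
    by have /invariant_setsP[] := iA n.
  apply: filterS (ae_foralln H) => nu h.
  by split => -[n _ /h Hn]; exists n.
Qed.

Lemma invariant_sets_measurable : invariant_sets P `<=` measurable.
Proof. by move=> A []. Qed.

(** Two real numbers with the same rational strict upper bounds are equal. *)
Lemma invariant_function (g : Borel (mstar R) -> R) :
  (forall B : set R, measurable B -> invariant_sets P (g @^-1` B)) ->
  {ae P, forall nu : Borel (mstar R), g (tmap nu) = g nu}.
Proof.
move=> mg.
have H (q : rat) : {ae P, forall nu : Borel (mstar R), g nu < ratr q <-> g (tmap nu) < ratr q}.
  have /invariant_setsP[_] := mg `]-oo, (ratr q)[%classic (measurable_itv _).
  by apply: filterS => nu; rewrite /= !in_itv.
apply: filterS (ae_forall_count H) => nu h.
apply/eqP; rewrite eq_le !leNgt; apply/andP; split; apply/negP => /rat_in_itvoo[q];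
  rewrite in_itv/= => /andP[q1 q2].
  by have /h := q1; rewrite ltNge (ltW q2).
by have /h := q1; rewrite ltNge (ltW q2).
Qed.

End invariant_sets.

(** * The ratio ergodic theorem *)

Section ratio_ergodic_theorem.
Context {R : realType} (p : nat) (hp : (2 <= p)%N) (Q : probability (Borel (phase R hp)) R).
Hypotheses (adQ : adapted Q) (invQ : Defs.invariant Q) (ergQ : ergodic Q).
Hypothesis ndQ : ~ deterministic Q.

Local Notation mu := (nu_law Q).
Implicit Types (nu : Borel (mstar R)) (f g h : Borel (mstar R) -> R).

Lemma unit_mass_law : {ae mu, forall nu, mass (nu : mstar R) 0 1 = 1}.
Proof.
apply: (ae_law (P := [set nu : Borel (mstar R) | mass (nu : mstar R) 0 1 = 1]));
  last exact: unit_mass.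
rewrite (_ : [set _ | _] = (fun nu : Borel (mstar R) => mass (nu : mstar R) 0 1) @^-1` [set 1]).
  by rewrite -[X in measurable X]setTI; exact: measurable_massR.
by [].
Qed.

(** Without return, the half-line would have the mass of [[0, 1)], which is 1. *)
Lemma return_law : {ae mu, forall nu, return_times (nu : mstar R) !=set0}.
Proof.
apply: filterS2 unit_mass_law (mass_unbounded adQ invQ ergQ ndQ) => nu nu1 unb.
apply: contrapT => nr; have [N] := unb 1; apply/negP; rewrite -leNgt.
rewrite -sum_unit_cell; case: N => [|N]; first by rewrite big_geq.
rewrite big_nat_recl// [X in X + _](nu1 : unit_cell 0 nu = 1).
rewrite [X in _ + X]big1_seq ?addr0// => k _.
apply/eqP; rewrite eq_le unit_cell_ge0 andbT leNgt; apply/negP => ck.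
by apply: nr; exists k.+1; apply/return_timesE.
Qed.

(** Almost sure invariance under one step of the return map holds at all the charged
    translates, because they avoid the exceptional null set. *)
Lemma charged_invariant g : (forall B : set R, measurable B -> invariant_sets mu (g @^-1` B)) ->
  {ae mu, forall nu, forall k, 0 < unit_cell k nu -> g (tstar k%:R nu) = g nu}.
Proof.
move=> /(invariant_function return_law) gt.
apply: filterS2 unit_mass_law (tstar_nonsingular adQ invQ ergQ ndQ gt) => nu nu1 H.
by apply: tstar_invariant => // k /H /contrapT.
Qed.

Lemma integrable_shift h (e : R) : mu.-integrable setT (EFin \o h) ->
  mu.-integrable setT (EFin \o (fun nu => h nu - e)).
Proof.
move=> ih.
have : mu.-integrable setT ((EFin \o h) \- cst e%:E)%E.
  by apply: integrableB => //; exact: finite_measure_integrable_cst.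
by apply: eq_integrable.
Qed.

Lemma weighted_sum_shift h (e : R) N nu :
  weighted_sum (fun nu => h nu - e) N nu = weighted_sum h N nu - e * mass (nu : mstar R) 0 N%:R.
Proof.
rewrite -sum_unit_cell /weighted_sum big_distrr -sumrB; apply: eq_bigr => k _ /=.
by rewrite mulrBr [e * _]mulrC.
Qed.

(** The maximal inequality is applied to [h - e] on the invariant set where its
    sums are unbounded; there some partial sum is always positive, so the integral
    of [h - e] is nonnegative, whereas it equals [- e] times the measure of the set. *)
Lemma weighted_sum_negligible h (e : R) : mu.-integrable setT (EFin \o h) -> 0 < e ->
  (forall A, invariant_sets mu A -> \int[mu]_(nu in A) (h nu)%:E = 0)%E ->
  {ae mu, forall nu, exists C, forall N,
    weighted_sum h N nu <= e * mass (nu : mstar R) 0 N%:R + C}.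
Proof.
move=> ih e0 h0; pose H nu := h nu - e.
have iH : mu.-integrable setT (EFin \o H) by exact: integrable_shift.
have mEH := measurable_int mu iH.
have mH : measurable_fun setT H by exact/measurable_EFinP.
pose E := unbounded_sums H; have mE : measurable E by exact: measurable_unbounded_sums.
have JE : invariant_sets mu E.
  apply/(invariant_setsP return_law); split => //.
  apply: filterS return_law => nu /tmap_charged[ct ->].
  by apply: iff_sym; exact: unbounded_sums_tstar.
(* The maximal inequality on [E]: the sums of the restriction of [H] are those of [H]
   on [E], and vanish elsewhere. *)
pose F nu := H nu * \1_E nu.
have FE : EFin \o F = ((EFin \o H) \_ E)%E.
  by apply/funext => nu; rewrite patchE /F /= indicE; case: ifP => _; rewrite ?mulr1 ?mulr0.
have iF : mu.-integrable setT (EFin \o F).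
  by rewrite FE; apply/(integrable_mkcond _ mE); exact: integrableS iH.
have wF N nu : weighted_sum F N nu = weighted_sum H N nu * \1_E nu.
  by apply: weighted_sum_restrict => k ck; exact: unbounded_sums_tstar.
have DE : \bigcup_N [set nu | 0 < weighted_sum F N nu] = E.
  apply/seteqP; split => nu.
    move=> [N _ /=]; rewrite wF indicE; case: (boolP (nu \in E)) => [/set_mem//|_].
    by rewrite mulr0 ltxx.
  move=> Enu; have [N N0] := Enu 0%N; exists N => //=.
  by rewrite wF indicE mem_set// mulr1.
have := half_line_maximal_inequality adQ invQ ergQ ndQ iF; rewrite DE.
have -> : (\int[mu]_(nu in E) (F nu)%:E = - (e%:E * mu E))%E.
  transitivity (\int[mu]_(nu in E) ((h nu)%:E - e%:E))%E.
    by apply: eq_integral => nu nuE; rewrite /F indicE nuE mulr1.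
  rewrite integralB//; last 2 first.
  - exact: integrableS ih.
  - by apply: finite_measure_integrable_cst.
  by rewrite h0// sub0e integral_cst.
rewrite oppe_ge0 => muE.
have muE0 : mu E = 0%E.
  apply/eqP; rewrite eq_le measure_ge0 andbT.
  by rewrite -(@lee_pmul2l _ e%:E)// ?mule0 ?lte_fin.
have : {ae mu, forall nu, ~ E nu}.
  by apply: negligibleS ((negligibleP mu mE).2 muE0) => nu /= /contrapT.
apply: filterS => nu nE.
have [C HC] : exists C : nat, forall N, weighted_sum H N nu <= C%:R.
  apply: contrapT => nC; apply: nE => C; apply: contrapT => nN; apply: nC; exists C => N.
  by rewrite leNgt; apply/negP => CN; apply: nN; exists N.
exists C%:R => N; rewrite -lerBlDl -weighted_sum_shift; exact: HC.
Qed.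

End ratio_ergodic_theorem.

(** The additive constants disappear because the masses are unbounded. *)
Lemma ratio_cvg (R : realType) (s m : nat -> R) (c : R) :
  (forall C : R, exists N, C < m N) -> {homo m : a b / (a <= b)%N >-> a <= b} ->
  (forall e : R, 0 < e -> exists C, forall N, s N - c * m N <= e * m N + C) ->
  (forall e : R, 0 < e -> exists C, forall N, c * m N - s N <= e * m N + C) ->
  (fun N => (m N)^-1 * s N) @ \oo --> c.
Proof.
move=> mu_unb mu_nd up lo; apply/cvgrPdist_le => e e0.
have e20 : 0 < e / 2 by rewrite divr_gt0.
have [C1 up1] := up _ e20; have [C2 lo1] := lo _ e20.
(* Beyond mass [B], the additive constants are absorbed by half of the error. *)
pose B := Num.max 1 (Num.max C1 C2 / (e / 2)).
have [N0 N0B] := mu_unb B.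
exists N0 => // N /= N0N.
have mB : B < m N := lt_le_trans N0B (mu_nd _ _ N0N).
have m0 : 0 < m N by apply: lt_trans mB; rewrite /B lt_max ltr01.
have Cm : Num.max C1 C2 <= e / 2 * m N.
  by rewrite mulrC -ler_pdivrMr//; apply: ltW; apply: le_lt_trans mB;
    rewrite /B le_max lexx orbT.
have [C1m C2m] : C1 <= e / 2 * m N /\ C2 <= e / 2 * m N.
  by move: Cm; rewrite ge_max => /andP.
have := up1 N; have := lo1 N => h1 h2.
rewrite -(ler_pM2r m0) -[X in _ * X <= _](gtr0_norm m0) -normrM mulrBl mulrAC mulVf ?gt_eqF//
  mul1r.
by rewrite ler_norml; apply/andP; split; lra.
Qed.

Lemma ae_conj d (T : measurableType d) (R : realType) (P : {measure set T -> \bar R})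
    (A B : T -> Prop) : {ae P, forall x, A x} -> {ae P, forall x, B x} ->
  {ae P, forall x, A x /\ B x}.
Proof. by move=> hA hB; apply: filterS2 hA hB => x; split. Qed.

Theorem theorem1p13 (R : realType) (p : nat) (hp : (2 <= p)%N)
    (Q : probability (Borel (phase R hp)) R)
    (hQ : extended_ECPD Q) (hnd : ~ deterministic Q)
    (f : Borel (mstar R) -> R)
    (hf : (nu_law Q).-integrable setT (EFin \o f)) :
  {ae nu_law Q, forall nu : mstar R,
    (fun N : nat =>
       (fine (nu `[0%R, N%:R[%classic))^-1 *
       \sum_(0 <= n < N) fine (nu `[n%:R, n.+1%:R[%classic) * f (tstar n%:R nu))
    @ \oo -->
    condexp (nu_law Q) (invariant_sets (nu_law Q)) f nu}.
Proof.
have [adQ invQ ergQ] := hQ.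
have ret := return_law adQ invQ ergQ hnd.
set P := nu_law Q in hf ret *; set g := condexp P (invariant_sets P) f.
have [mg ig gE] : is_condexp P (invariant_sets P) f g.
  exact: (condexpP (invariant_sets_sigma ret) (@invariant_sets_measurable R P)).
have mPfin A (k : Borel (mstar R) -> R) : P.-integrable setT (EFin \o k) -> measurable A ->
    P.-integrable A (EFin \o k) by move=> ik mA; exact: integrableS ik.
have bound (f1 f2 : Borel (mstar R) -> R) : P.-integrable setT (EFin \o f1) ->
    P.-integrable setT (EFin \o f2) ->
    (forall A, invariant_sets P A -> \int[P]_(x in A) (f1 x)%:E = \int[P]_(x in A) (f2 x)%:E)%E
      ->
    {ae P, forall nu, forall k : nat, exists C, forall N,
      weighted_sum (fun nu => f1 nu - f2 nu) N nu <= k.+1%:R^-1 * mass (nu : mstar R) 0 N%:R +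
        C}.
  move=> i1 i2 e12; apply: ae_foralln => k.
  apply: (weighted_sum_negligible adQ invQ ergQ hnd); last first.
  - move=> A JA; have mA : measurable A by have [] := JA.
    transitivity (\int[P]_(x in A) ((f1 x)%:E - (f2 x)%:E))%E.
      by apply: eq_integral => x _; rewrite EFinB.
    rewrite integralB//; [|exact: mPfin|exact: mPfin].
    by rewrite e12// subee// integrable_fin_num//; exact: mPfin.
  - by rewrite invr_gt0.
  - have : P.-integrable setT ((EFin \o f1) \- (EFin \o f2))%E by exact: integrableB.
    by apply: eq_integrable.
have fg := bound f g hf ig (fun A JA => esym (gE A JA)).
have gf := bound g f ig hf gE.
have inv := charged_invariant adQ invQ ergQ hnd mg.
have unb := mass_unbounded adQ invQ ergQ hnd.
suff : {ae P, forall nu : Borel (mstar R),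
    (fun N : nat => (mass (nu : mstar R) 0 N%:R)^-1 * weighted_sum f N nu) @ \oo --> g nu}
      by [].
apply: filterS2 (ae_conj fg gf) (ae_conj inv unb) => nu [fgn gfn] [invn unbn].
have wg N : weighted_sum g N nu = g nu * mass (nu : mstar R) 0 N%:R.
  rewrite -sum_unit_cell /weighted_sum big_distrr; apply: eq_bigr => k _ /=.
  have [ck|ck] := ltP 0 (unit_cell k nu); first by rewrite invn// mulrC.
  have -> : unit_cell k nu = 0 by apply/eqP; rewrite eq_le ck unit_cell_ge0.
  by rewrite mul0r mulr0.
have wB (f1 f2 : Borel (mstar R) -> R) N :
    weighted_sum (fun nu => f1 nu - f2 nu) N nu = weighted_sum f1 N nu - weighted_sum f2 N nu.
  by rewrite /weighted_sum -sumrB; apply: eq_bigr => k _; rewrite mulrBr.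
have small (e : R) : 0 < e -> exists k : nat, k.+1%:R^-1 <= e.
  by move=> /ltr_add_invr[k]; rewrite add0r => /ltW; exists k.
apply: ratio_cvg => //.
- by move=> a b ab; apply: mass_le => //; rewrite ler_nat.
- move=> e /small[k ke]; have [C HC] := fgn k; exists C => N.
  have := HC N; rewrite wB wg => /le_trans; apply.
  by rewrite lerD2r ler_wpM2r// mass_ge0.
- move=> e /small[k ke]; have [C HC] := gfn k; exists C => N.
  have := HC N; rewrite wB wg => /le_trans; apply.
  by rewrite lerD2r ler_wpM2r// mass_ge0.
Qed.
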